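(* Let $k$ be a field of characteristic zero. Every automorphism of the free Poisson algebra $k\{x,y\}$ in two variables over $k$ is tame.
   Context: A Poisson algebra over $k$ is a commutative associative algebra with identity $1$ endowed with a Lie bracket $\{x,y\}$ such that $\{x,yz\}=\{x,y\}z+y\{x,z\}$. $k\{x_1,\ldots,x_n\}$ denotes the free Poisson algebra on $x_1,\ldots,x_n$. An automorphism of $k\{x_1,\ldots,x_n\}$ is elementary if for some $i$ it fixes $x_j$ for all $j\neq i$ and sends $x_i\mapsto \alpha x_i+f$ with $0\neq\alpha\in k$ and $f\in k\{x_1,\ldots,x_{i-1},x_{i+1},\ldots,x_n\}$; an automorphism is tame if it is a composition of elementary automorphisms. *)

(* Defs.v *)
From HB Require Import structures.
From mathcomp Require Import all_boot all_order all_algebra.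
From mathcomp Require Import boolp.

Set Implicit Arguments.
Unset Strict Implicit.
Unset Printing Implicit Defensive.

Import GRing.Theory.
Local Open Scope ring_scope.
Local Open Scope quotient_scope.

(* Like all MathComp algebras, a [poissonAlgType] satisfies 1 != 0. *)
HB.mixin Record isPoisson (k : fieldType) P of GRing.ComAlgebra k P := {
  bracket : P -> P -> P;
  bracket_linearl : forall (a : k) (x y z : P),
    bracket (a *: x + y) z = a *: bracket x z + bracket y z;
  bracket_linearr : forall (a : k) (x y z : P),
    bracket x (a *: y + z) = a *: bracket x y + bracket x z;
  bracketxx : forall x : P, bracket x x = 0;
  bracket_jacobi : forall x y z : P,
    bracket x (bracket y z) + bracket y (bracket z x) + bracket z (bracket x y)
      = 0;
  bracket_leibniz : forall x y z : P,
    bracket x (y * z) = bracket x y * z + y * bracket x z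
}.

#[short(type="poissonAlgType")]
HB.structure Definition PoissonAlgebra (k : fieldType) :=
  {P of GRing.ComAlgebra k P & isPoisson k P}.

Definition poisson_morphism (k : fieldType) (P Q : poissonAlgType k)
    (f : P -> Q) : Prop :=
  [/\ linear f, monoid_morphism f
    & forall x y, f (bracket x y) = bracket (f x) (f y)].

Definition poisson_automorphism (k : fieldType) (P : poissonAlgType k)
    (f : P -> P) : Prop :=
  poisson_morphism f /\ bijective f.

Inductive poisson_generated (k : fieldType) (P : poissonAlgType k)
    (S : P -> Prop) : P -> Prop :=
| PGen x of S x : poisson_generated S x
| POne : poisson_generated S 1
| PLin (a : k) x y of poisson_generated S x & poisson_generated S y :
    poisson_generated S (a *: x + y)
| PMul x y of poisson_generated S x & poisson_generated S y :
    poisson_generated S (x * y)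
| PBracket x y of poisson_generated S x & poisson_generated S y :
    poisson_generated S (bracket x y).

(* The free Poisson algebra is the term algebra modulo the smallest
   congruence [teq] that forces the axioms of Poisson algebras; it is
   characterized by [freePoisson_universal]. *)
Section FreePoisson.
Variables (k : fieldType) (n : nat).

Inductive term :=
| TVar of 'I_n
| TZero
| TOne
| TOpp of term
| TAdd of term & term
| TScale of k & term
| TMul of term & term
| TBracket of term & term.

Inductive teq : term -> term -> Prop :=
| teq_refl s : teq s s
| teq_sym s t of teq s t : teq t s
| teq_trans s t u of teq s t & teq t u : teq s u
| teq_opp s s' of teq s s' : teq (TOpp s) (TOpp s')
| teq_add s s' t t' of teq s s' & teq t t' : teq (TAdd s t) (TAdd s' t')
| teq_scale a s s' of teq s s' : teq (TScale a s) (TScale a s')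
| teq_mul s s' t t' of teq s s' & teq t t' : teq (TMul s t) (TMul s' t')
| teq_bracket s s' t t' of teq s s' & teq t t' :
    teq (TBracket s t) (TBracket s' t')
| teq_addA s t u : teq (TAdd s (TAdd t u)) (TAdd (TAdd s t) u)
| teq_addC s t : teq (TAdd s t) (TAdd t s)
| teq_add0 s : teq (TAdd TZero s) s
| teq_addN s : teq (TAdd (TOpp s) s) TZero
| teq_scaleA a b s : teq (TScale a (TScale b s)) (TScale (a * b) s)
| teq_scale1 s : teq (TScale 1 s) s
| teq_scaleDr a s t : teq (TScale a (TAdd s t)) (TAdd (TScale a s) (TScale a t))
| teq_scaleDl a b s : teq (TScale (a + b) s) (TAdd (TScale a s) (TScale b s))
| teq_mulA s t u : teq (TMul s (TMul t u)) (TMul (TMul s t) u)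
| teq_mulC s t : teq (TMul s t) (TMul t s)
| teq_mul1 s : teq (TMul TOne s) s
| teq_mulDl s t u : teq (TMul (TAdd s t) u) (TAdd (TMul s u) (TMul t u))
| teq_scaleAl a s t : teq (TScale a (TMul s t)) (TMul (TScale a s) t)
| teq_bracket_linl a s t u :
    teq (TBracket (TAdd (TScale a s) t) u)
        (TAdd (TScale a (TBracket s u)) (TBracket t u))
| teq_bracket_linr a s t u :
    teq (TBracket s (TAdd (TScale a t) u))
        (TAdd (TScale a (TBracket s t)) (TBracket s u))
| teq_bracketxx s : teq (TBracket s s) TZero
| teq_jacobi s t u :
    teq (TAdd (TAdd (TBracket s (TBracket t u)) (TBracket t (TBracket u s)))
              (TBracket u (TBracket s t))) TZero
| teq_leibniz s t u :
    teq (TBracket s (TMul t u))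
        (TAdd (TMul (TBracket s t) u) (TMul t (TBracket s u))).

HB.instance Definition _ := gen_eqMixin term.
HB.instance Definition _ := gen_choiceMixin term.

Definition teqb : rel term := fun s t => `[< teq s t >].

Lemma teqb_refl : reflexive teqb.
Proof. by move=> s; apply/asboolP/teq_refl. Qed.

Lemma teqb_sym : symmetric teqb.
Proof. by move=> s t; apply/idP/idP => /asboolP/teq_sym/asboolP. Qed.

Lemma teqb_trans : transitive teqb.
Proof.
by move=> t s u /asboolP st /asboolP tu; apply/asboolP/(teq_trans st tu).
Qed.

Canonical teqb_equiv := EquivRel teqb teqb_refl teqb_sym teqb_trans.

Definition freePoisson := {eq_quot teqb}.
HB.instance Definition _ := Choice.on freePoisson.

Let cl (s : term) : freePoisson := \pi_{eq_quot teqb} s.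
Let rp (x : freePoisson) : term := repr (x : {eq_quot teqb}).

Let clP s t : teq s t <-> cl s = cl t.
Proof.
by split=> [st | /eqmodP/asboolP //]; apply/eqmodP/asboolP.
Qed.

Let rpP s : teq (rp (cl s)) s.
Proof. by apply/clP; rewrite /cl /rp reprK. Qed.

Let clK x : cl (rp x) = x.
Proof. by rewrite /cl /rp reprK. Qed.

Definition pvar (i : 'I_n) : freePoisson := cl (TVar i).
Definition fp_zero : freePoisson := cl TZero.
Definition fp_one : freePoisson := cl TOne.
Definition fp_opp x : freePoisson := cl (TOpp (rp x)).
Definition fp_add x y : freePoisson := cl (TAdd (rp x) (rp y)).
Definition fp_scale a x : freePoisson := cl (TScale a (rp x)).
Definition fp_mul x y : freePoisson := cl (TMul (rp x) (rp y)).
Definition fp_bracket x y : freePoisson := cl (TBracket (rp x) (rp y)).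

Let cl_opp s : fp_opp (cl s) = cl (TOpp s).
Proof. by apply/clP/teq_opp/rpP. Qed.
Let cl_add s t : fp_add (cl s) (cl t) = cl (TAdd s t).
Proof. by apply/clP/teq_add; apply: rpP. Qed.
Let cl_scale a s : fp_scale a (cl s) = cl (TScale a s).
Proof. by apply/clP/teq_scale/rpP. Qed.
Let cl_mul s t : fp_mul (cl s) (cl t) = cl (TMul s t).
Proof. by apply/clP/teq_mul; apply: rpP. Qed.
Let cl_bracket s t : fp_bracket (cl s) (cl t) = cl (TBracket s t).
Proof. by apply/clP/teq_bracket; apply: rpP. Qed.

Let clE := (cl_opp, cl_add, cl_scale, cl_mul, cl_bracket).

Let fpW (A : freePoisson -> Prop) : (forall s, A (cl s)) -> forall x, A x.
Proof. by move=> As x; rewrite -[x]clK. Qed.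

Let fp_addA : associative fp_add.
Proof.
by elim/fpW=> s; elim/fpW=> t; elim/fpW=> u; rewrite !clE; apply/clP/teq_addA.
Qed.
Let fp_addC : commutative fp_add.
Proof. by elim/fpW=> s; elim/fpW=> t; rewrite !clE; apply/clP/teq_addC. Qed.
Let fp_add0 : left_id fp_zero fp_add.
Proof. by elim/fpW=> s; rewrite !clE; apply/clP/teq_add0. Qed.
Let fp_addN : left_inverse fp_zero fp_opp fp_add.
Proof. by elim/fpW=> s; rewrite !clE; apply/clP/teq_addN. Qed.

HB.instance Definition _ :=
  GRing.isZmodule.Build freePoisson fp_addA fp_addC fp_add0 fp_addN.

Let fp_mulA : associative fp_mul.
Proof.
by elim/fpW=> s; elim/fpW=> t; elim/fpW=> u; rewrite !clE; apply/clP/teq_mulA.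
Qed.
Let fp_mulC : commutative fp_mul.
Proof. by elim/fpW=> s; elim/fpW=> t; rewrite !clE; apply/clP/teq_mulC. Qed.
Let fp_mul1 : left_id fp_one fp_mul.
Proof. by elim/fpW=> s; rewrite !clE; apply/clP/teq_mul1. Qed.
Let fp_mulDl : left_distributive fp_mul fp_add.
Proof.
by elim/fpW=> s; elim/fpW=> t; elim/fpW=> u; rewrite !clE; apply/clP/teq_mulDl.
Qed.

(* Evaluation in k with the zero bracket shows that the quotient is not 0. *)
Fixpoint eval0 (s : term) : k :=
  match s with
  | TVar _ | TZero | TBracket _ _ => 0
  | TOne => 1
  | TOpp s => - eval0 s
  | TAdd s t => eval0 s + eval0 t
  | TScale a s => a * eval0 s
  | TMul s t => eval0 s * eval0 t
  end.

Let eval0_teq s t : teq s t -> eval0 s = eval0 t.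
Proof.
elim=> {s t} //=.
- by move=> s t u _ -> _ ->.
- by move=> s t _ ->.
- by move=> s s' t t' _ -> _ ->.
- by move=> a s s' _ ->.
- by move=> s s' t t' _ -> _ ->.
- by move=> *; rewrite addrA.
- by move=> *; rewrite addrC.
- by move=> *; rewrite add0r.
- by move=> *; rewrite addNr.
- by move=> *; rewrite mulrA.
- by move=> *; rewrite mul1r.
- by move=> *; rewrite mulrDr.
- by move=> *; rewrite mulrDl.
- by move=> *; rewrite mulrA.
- by move=> *; rewrite mulrC.
- by move=> *; rewrite mul1r.
- by move=> *; rewrite mulrDl.
- by move=> *; rewrite mulrA.
- by move=> *; rewrite mulr0 addr0.
- by move=> *; rewrite mulr0 addr0.
- by move=> *; rewrite !addr0.
- by move=> *; rewrite mul0r mulr0 addr0.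
Qed.

Let fp_one_neq0 : fp_one != fp_zero.
Proof.
by apply/eqP => /clP/eval0_teq /= /eqP; rewrite oner_eq0.
Qed.

HB.instance Definition _ := GRing.Zmodule_isComNzRing.Build freePoisson
  fp_mulA fp_mulC fp_mul1 fp_mulDl fp_one_neq0.

Let fp_scaleA a b x : fp_scale a (fp_scale b x) = fp_scale (a * b) x.
Proof. by elim/fpW: x => s; rewrite !clE; apply/clP/teq_scaleA. Qed.
Let fp_scale1 : left_id 1 fp_scale.
Proof. by elim/fpW=> s; rewrite !clE; apply/clP/teq_scale1. Qed.
Let fp_scaleDr : right_distributive fp_scale +%R.
Proof.
move=> a; elim/fpW=> s; elim/fpW=> t.
by rewrite /GRing.add /= !clE; apply/clP/teq_scaleDr.
Qed.
Let fp_scaleDl x : {morph fp_scale^~ x : a b / a + b}.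
Proof.
move=> a b; elim/fpW: x => s.
by rewrite /GRing.add /= !clE; apply/clP/teq_scaleDl.
Qed.

HB.instance Definition _ := GRing.Zmodule_isLmodule.Build k freePoisson
  fp_scaleA fp_scale1 fp_scaleDr fp_scaleDl.

Let fp_scaleAl (a : k) (x y : freePoisson) : a *: (x * y) = (a *: x) * y.
Proof.
elim/fpW: x => s; elim/fpW: y => t.
by rewrite /GRing.mul /GRing.scale /= !clE; apply/clP/teq_scaleAl.
Qed.

HB.instance Definition _ :=
  GRing.Lmodule_isLalgebra.Build k freePoisson fp_scaleAl.
HB.instance Definition _ := GRing.Lalgebra_isComAlgebra.Build k freePoisson.

Let fp_bracket_linl (a : k) (x y z : freePoisson) :
  fp_bracket (a *: x + y) z = a *: fp_bracket x z + fp_bracket y z.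
Proof.
elim/fpW: x => s; elim/fpW: y => t; elim/fpW: z => u.
by rewrite /GRing.add /GRing.scale /= !clE; apply/clP/teq_bracket_linl.
Qed.
Let fp_bracket_linr (a : k) (x y z : freePoisson) :
  fp_bracket x (a *: y + z) = a *: fp_bracket x y + fp_bracket x z.
Proof.
elim/fpW: x => s; elim/fpW: y => t; elim/fpW: z => u.
by rewrite /GRing.add /GRing.scale /= !clE; apply/clP/teq_bracket_linr.
Qed.
Let fp_bracketxx x : fp_bracket x x = 0.
Proof. by elim/fpW: x => s; rewrite !clE; apply/clP/teq_bracketxx. Qed.
Let fp_jacobi x y z :
  fp_bracket x (fp_bracket y z) + fp_bracket y (fp_bracket z x)
    + fp_bracket z (fp_bracket x y) = 0.
Proof.
elim/fpW: x => s; elim/fpW: y => t; elim/fpW: z => u.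
by rewrite /GRing.add /= !clE; apply/clP/teq_jacobi.
Qed.
Let fp_leibniz (x y z : freePoisson) :
  fp_bracket x (y * z) = fp_bracket x y * z + y * fp_bracket x z.
Proof.
elim/fpW: x => s; elim/fpW: y => t; elim/fpW: z => u.
by rewrite /GRing.add /GRing.mul /= !clE; apply/clP/teq_leibniz.
Qed.

HB.instance Definition _ := isPoisson.Build k freePoisson
  fp_bracket_linl fp_bracket_linr fp_bracketxx fp_jacobi fp_leibniz.

Section Universal.
Variables (Q : poissonAlgType k) (v : 'I_n -> Q).

Fixpoint eval (s : term) : Q :=
  match s with
  | TVar i => v i
  | TZero => 0
  | TOne => 1
  | TOpp s => - eval s
  | TAdd s t => eval s + eval t
  | TScale a s => a *: eval s
  | TMul s t => eval s * eval t
  | TBracket s t => bracket (eval s) (eval t)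
  end.

Let eval_teq s t : teq s t -> eval s = eval t.
Proof.
elim=> {s t} //=.
- by move=> s t u _ -> _ ->.
- by move=> s t _ ->.
- by move=> s s' t t' _ -> _ ->.
- by move=> a s s' _ ->.
- by move=> s s' t t' _ -> _ ->.
- by move=> s s' t t' _ -> _ ->.
- by move=> *; rewrite addrA.
- by move=> *; rewrite addrC.
- by move=> *; rewrite add0r.
- by move=> *; rewrite addNr.
- by move=> *; rewrite scalerA.
- by move=> *; rewrite scale1r.
- by move=> *; rewrite scalerDr.
- by move=> *; rewrite scalerDl.
- by move=> *; rewrite mulrA.
- by move=> *; rewrite mulrC.
- by move=> *; rewrite mul1r.
- by move=> *; rewrite mulrDl.
- by move=> *; rewrite scalerAl.
- by move=> *; rewrite bracket_linearl.
- by move=> *; rewrite bracket_linearr.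
- by move=> *; rewrite bracketxx.
- by move=> *; rewrite bracket_jacobi.
- by move=> *; rewrite bracket_leibniz.
Qed.

Definition fp_lift (x : freePoisson) : Q := eval (rp x).

Let fp_lift_cl s : fp_lift (cl s) = eval s.
Proof. exact/eval_teq/rpP. Qed.

Lemma fp_lift_pvar i : fp_lift (pvar i) = v i.
Proof. exact: fp_lift_cl. Qed.

Lemma fp_lift_morphism : poisson_morphism (fp_lift : freePoisson -> Q).
Proof.
split=> [a x y | | x y].
- by rewrite [LHS]fp_lift_cl /= (eval_teq (rpP _)).
- by split=> [| x y]; rewrite [LHS]fp_lift_cl.
- by rewrite [LHS]fp_lift_cl.
Qed.

Lemma fp_lift_unique (g : freePoisson -> Q) :
  poisson_morphism g -> (forall i, g (pvar i) = v i) -> g =1 fp_lift.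
Proof.
case=> glin [g1 gM] gB gv; elim/fpW=> s; rewrite fp_lift_cl.
have gD x y : g (x + y) = g x + g y by have := glin 1 x y; rewrite !scale1r.
have g0 : g 0 = 0 by apply: (addrI (g 0)); rewrite -gD !addr0.
have gZ a x : g (a *: x) = a *: g x by rewrite -[a *: x]addr0 glin g0 addr0.
have gN x : g (- x) = - g x by rewrite -scaleN1r gZ scaleN1r.
elim: s => /= [i||| s <- | s <- t <- | a s <- | s <- t <- | s <- t <-].
- exact: gv.
- exact: g0.
- exact: g1.
- by rewrite -gN -cl_opp.
- by rewrite -gD -cl_add.
- by rewrite -gZ -cl_scale.
- by rewrite -gM -cl_mul.
- by rewrite -gB -cl_bracket.
Qed.

End Universal.
End FreePoisson.

Theorem freePoisson_universal (k : fieldType) (n : nat) (Q : poissonAlgType k)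
    (v : 'I_n -> Q) :
  exists f : freePoisson k n -> Q,
    [/\ poisson_morphism f, forall i, f (pvar k i) = v i
      & forall g : freePoisson k n -> Q,
          poisson_morphism g -> (forall i, g (pvar k i) = v i) -> g =1 f].
Proof.
exists (fp_lift v); split; first exact: fp_lift_morphism.
- exact: fp_lift_pvar.
- exact: fp_lift_unique.
Qed.

(* k{x_1, .., x_(i-1), x_(i+1), .., x_n} is the Poisson subalgebra of
   k{x_1, .., x_n} generated by the x_j, j != i. *)
Definition elementary_automorphism (k : fieldType) (n : nat)
    (phi : freePoisson k n -> freePoisson k n) : Prop :=
  poisson_automorphism phi /\
  exists (i : 'I_n) (a : k) (f : freePoisson k n),
    [/\ a != 0,
        poisson_generated (fun y => exists2 j, j != i & y = pvar k j) f,
        forall j, j != i -> phi (pvar k j) = pvar k j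
      & phi (pvar k i) = a *: pvar k i + f].

(* The empty composition (m = 0) is the identity. *)
Definition tame_automorphism (k : fieldType) (n : nat)
    (phi : freePoisson k n -> freePoisson k n) : Prop :=
  exists (m : nat) (e : 'I_m -> freePoisson k n -> freePoisson k n),
    (forall i, elementary_automorphism (e i)) /\
    phi =1 \big[comp/idfun]_(i < m) e i.

(* Main.v *)
(* Every automorphism of k{x, y} maps x and y into k[x, y]. The universal
   derivation d of P = k{x, y} takes its values in the words in x, y with
   coefficients in P, where it sends Lie monomials to Lie polynomials. If phi
   is an automorphism, then d(phi x) and d(phi y) generate the letters x and y
   over the Poisson enveloping algebra of P. If one of them had degree larger
   than 1, their leading parts would be left dependent, and one would be a left
   multiple of the other one after a reduction of degrees; but in
   characteristic zero a Lie polynomial is never a proper left multiple of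
   another one. Hence d(phi x) and d(phi y) have degree 1, which characterizes
   the elements of k[x, y] by the Dynkin-Specht-Wever formula.

   This leaves the theorem of Jung. Let f and g be the images of x and y, of
   degrees n <= m. If n + m > 2, their leading forms have zero Jacobian, and n
   divides m: otherwise the exponents of the leading weighted part of the
   polynomial G with G(f, g) = y are so sparse that the multiplicity of its
   root at the leading form of g forces the degree of G(f, g) to be larger than
   1. So the leading form of g is a multiple of a power of that of f, and an
   elementary automorphism lowers the degree. *)
From HB Require Import structures.
From mathcomp Require Import all_boot all_algebra.
From mathcomp Require Import boolp ring zify.
Require Import Defs.

Set Implicit Arguments.
Unset Strict Implicit.
Unset Printing Implicit Defensive.

Import GRing.Theory.
Local Open Scope ring_scope.

(** The Poisson enveloping algebra of [P] acts on words with coefficients in [P]. Brackets with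
    coefficients never lengthen a word, so in top degree the action is plain concatenation. A letter
    has degree 1, hence in any expression of a letter through d(phi x) and d(phi y) the parts of
    degree at least 2 cancel; this is the source of the relations between leading parts. As [P] is a
    domain and not a field, these relations can only be solved up to a nonzero factor, and such
    denominators are carried through all statements. The obstacle is a leading part that is a left
    multiple of another one of smaller degree. It is excluded by duality: contraction by a Lie
    element is a derivation of the shuffle algebra (one half of Ree's criterion), and characteristic
    zero allows the division by the integers that the Leibniz rule produces. Degrees inside [P] are
    measured by a filtration, and the Euler derivation recovers an element from its differential up
    to lower terms; this also yields that [P] is a domain. *)

(** * Words: concatenation and shuffle products *)

Section Words.
Variables (I : finType) (R : comPzRingType).
Implicit Types (n m l F G : seq I -> R) (a b c : R) (s t w : seq I).

(** A function on words stands for a noncommutative power series. This is the product of series, a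
    sum over all cuts of [w]; the recursion moves the cut to the right by absorbing letters into
    [n]. *)
Fixpoint conv n m w : R :=
  if w is i :: w' then n [::] * m w + conv (fun s => n (i :: s)) m w'
  else n [::] * m [::].

Lemma conv_nil n m : conv n m [::] = n [::] * m [::]. Proof. by []. Qed.

Lemma conv_cons n m i w :
  conv n m (i :: w) = n [::] * m (i :: w) + conv (fun s => n (i :: s)) m w.
Proof. by []. Qed.

Lemma eq_conv n n' m m' : n =1 n' -> m =1 m' -> conv n m =1 conv n' m'.
Proof.
move=> en em w; elim: w n n' en => [|i w IHw] n n' en /=; rewrite en em //.
by congr (_ + _); apply: IHw => s; apply: en.
Qed.

Lemma conv_linl a n n' m w :
  conv (fun s => a * n s + n' s) m w = a * conv n m w + conv n' m w.
Proof.
elim: w n n' => [|i w IHw] n n' /=; first by ring.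
by rewrite IHw; ring.
Qed.

Lemma conv_linr a n m m' w :
  conv n (fun s => a * m s + m' s) w = a * conv n m w + conv n m' w.
Proof.
elim: w n => [|i w IHw] n /=; first by ring.
by rewrite IHw; ring.
Qed.

Lemma convA n m l w : conv n (conv m l) w = conv (conv n m) l w.
Proof.
elim: w n m => [|i w IHw] n m; first by rewrite !conv_nil mulrA.
rewrite !conv_cons /= conv_linl -IHw.
by ring.
Qed.

Lemma conv_der (D : R -> R) :
    (forall a b, D (a + b) = D a + D b) ->
    (forall a b, D (a * b) = D a * b + a * D b) ->
  forall n m w,
    D (conv n m w) = conv (fun s => D (n s)) m w + conv n (fun s => D (m s)) w.
Proof.
move=> DD DM n m w; elim: w n => [|i w IHw] n /=; first by rewrite DM.
by rewrite DD DM IHw; ring.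
Qed.

Fixpoint wsum d F : R :=
  if d is d'.+1 then \sum_i wsum d' (fun s => F (i :: s)) else F [::].

Lemma eq_wsum d F G : (forall s, size s = d -> F s = G s) -> wsum d F = wsum d G.
Proof.
elim: d F G => [|d IHd] F G eFG /=; first exact: eFG.
by apply: eq_bigr => i _; apply: IHd => s sd; apply: eFG; rewrite /= sd.
Qed.

Lemma wsum_lin d a F G :
  wsum d (fun s => a * F s + G s) = a * wsum d F + wsum d G.
Proof.
elim: d F G => [|d IHd] F G //=.
by rewrite mulr_sumr -big_split; apply: eq_bigr => i _ /=; rewrite -IHd.
Qed.

Lemma wsum0 d F : (forall s, size s = d -> F s = 0) -> wsum d F = 0.
Proof.
elim: d F => [|d IHd] F F0 /=; first exact: F0.
by apply: big1 => i _; apply: IHd => s sd; apply: F0; rewrite /= sd.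
Qed.

Lemma wsumZ d a F : wsum d (fun s => a * F s) = a * wsum d F.
Proof.
transitivity (wsum d (fun s => a * F s + 0)); first by apply: eq_wsum => s _; rewrite addr0.
by rewrite (wsum_lin d a F (fun=> 0)) (wsum0 (F := fun=> 0)) ?addr0.
Qed.

Lemma wsumD d F G : wsum d (fun s => F s + G s) = wsum d F + wsum d G.
Proof.
transitivity (wsum d (fun s => 1 * F s + G s)); first by apply: eq_wsum => s _; rewrite mul1r.
by rewrite wsum_lin mul1r.
Qed.

Lemma wsumN d F : wsum d (fun s => - F s) = - wsum d F.
Proof.
rewrite -mulN1r -wsumZ; apply: eq_wsum => s _; by rewrite mulN1r.
Qed.

Lemma wsumB d F G : wsum d (fun s => F s - G s) = wsum d F - wsum d G.
Proof. by rewrite wsumD wsumN. Qed.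

Lemma wsum_cat d e F :
  wsum (d + e)%N F = wsum d (fun s => wsum e (fun t => F (s ++ t))).
Proof.
elim: d F => [|d IHd] F //=.
by apply: eq_bigr => i _; rewrite IHd.
Qed.

Lemma wsum_single d F s0 : size s0 = d ->
  wsum d (fun s => F s * (s == s0)%:R) = F s0.
Proof.
move=> <- {d}; elim: s0 F => [|i s0 IHs] F /=; first by rewrite mulr1.
rewrite (bigD1 i) //= big1 ?addr0 => [|j ji].
  rewrite -(IHs (fun s => F (i :: s))).
  by apply: eq_wsum => s _; rewrite eqseq_cons eqxx.
by apply: wsum0 => s _; rewrite eqseq_cons (negbTE ji) mulr0.
Qed.

(** Shuffle product of functionals on words: the sum over all ways of distributing the letters of
    [w] between two subwords. *)
Fixpoint shuf F G w : R :=
  if w is i :: w' then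
    shuf (fun s => F (i :: s)) G w' + shuf F (fun s => G (i :: s)) w'
  else F [::] * G [::].

Lemma eq_shuf F F' G G' : F =1 F' -> G =1 G' -> shuf F G =1 shuf F' G'.
Proof.
move=> eF eG w; elim: w F F' G G' eF eG => [|i w IHw] F F' G G' eF eG /=.
  by rewrite eF eG.
by congr (_ + _); apply: IHw => // s; rewrite ?eF ?eG.
Qed.

Lemma shuf0l F w : shuf (fun=> 0) F w = 0.
Proof. by elim: w F => [|i w IHw] F /=; rewrite ?mul0r // !IHw addr0. Qed.

Lemma shuf0r F w : shuf F (fun=> 0) w = 0.
Proof. by elim: w F => [|i w IHw] F /=; rewrite ?mulr0 // !IHw addr0. Qed.

Lemma shuf_linl a F F' G w :
  shuf (fun s => a * F s + F' s) G w = a * shuf F G w + shuf F' G w.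
Proof.
elim: w F F' G => [|i w IHw] F F' G /=; first by ring.
by rewrite !IHw; ring.
Qed.

Lemma shuf_linr a F G G' w :
  shuf F (fun s => a * G s + G' s) w = a * shuf F G w + shuf F G' w.
Proof.
elim: w F G G' => [|i w IHw] F G G' /=; first by ring.
by rewrite !IHw; ring.
Qed.

Lemma shuf_unitl c G w : shuf (fun s => c * (s == [::])%:R) G w = c * G w.
Proof.
elim: w G => [|i w IHw] G /=; first by rewrite mulr1.
rewrite IHw (eq_shuf (F' := fun=> 0) (G' := G)) //; first by rewrite shuf0l add0r.
by move=> s; rewrite mulr0.
Qed.

(** The recursion of [shuf] removes first letters whereas right contractions remove last ones; this
    symmetry makes the contraction by one letter a derivation. *)
Lemma shuf_rcons F G w i : shuf F G (rcons w i) =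
  shuf (fun s => F (rcons s i)) G w + shuf F (fun s => G (rcons s i)) w.
Proof.
elim: w F G => [|j w IHw] F G //=.
by rewrite !IHw; ring.
Qed.

Definition homogeneous_word (d : nat) F := forall s, size s != d -> F s = 0.

Lemma shuf_hom (d e : nat) F G :
  homogeneous_word d F -> homogeneous_word e G -> homogeneous_word (d + e)%N (shuf F G).
Proof.
move=> hF hG w; elim: w d e F G hF hG => [|i w IHw] d e F G hF hG /= sw.
  case: d hF sw => [|d] hF sw; last by rewrite hF ?mul0r.
  by rewrite hG ?mulr0.
rewrite -[RHS](addr0 0); congr (_ + _).
  case: d hF sw => [|d] hF sw.
    rewrite (eq_shuf (F' := fun=> 0) (G' := G)) ?shuf0l //.
    by move=> s; apply: hF.
  apply: (IHw d e) => //; first by move=> s sd; apply: hF.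
case: e hG sw => [|e] hG sw.
  rewrite (eq_shuf (F' := F) (G' := fun=> 0)) ?shuf0r //.
  by move=> s; apply: hG.
apply: (IHw d e) => //.
  by move=> s sd; apply: hG.
by rewrite addnS eqSS in sw.
Qed.

(* [wder d n] is the right contraction by the part of degree [d] of [n]. *)
Definition wder d n F w := wsum d (fun s => n s * F (w ++ s)).

Definition shuf_derivation (D : (seq I -> R) -> seq I -> R) :=
  forall F G w, D (shuf F G) w = shuf (D F) G w + shuf F (D G) w.

End Words.

(** * Lie polynomials as words, and their contractions *)

Inductive lie (I : Type) := LieVar of I | LieBr of lie I & lie I.

Fixpoint lie_deg I (e : lie I) : nat :=
  if e is LieBr e f then (lie_deg e + lie_deg f)%N else 1.

Lemma lie_deg_gt0 I (e : lie I) : (0 < lie_deg e)%N.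
Proof. by elim: e => //= e He f _; rewrite addn_gt0 He. Qed.
Section LieWords.
Variables (I : finType) (k : fieldType).
Implicit Types (e f : lie I) (s t w : seq I).

(* The image of a Lie monomial in the free associative algebra. *)
Fixpoint lie_word e w : k :=
  match e with
  | LieVar i => (w == [:: i])%:R
  | LieBr e f =>
    conv (lie_word e) (lie_word f) w - conv (lie_word f) (lie_word e) w
  end.

Lemma conv0l (R : comPzRingType) (n m : seq I -> R) w :
  (forall s, n s = 0) -> conv n m w = 0.
Proof.
elim: w n => [|i w IHw] n n0 /=; rewrite n0 mul0r ?add0r //.
by apply: IHw => s; apply: n0.
Qed.

Lemma conv_hom (R : comPzRingType) (d e : nat) (n m : seq I -> R) :
  homogeneous_word d n -> homogeneous_word e m -> homogeneous_word (d + e)%N (conv n m).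
Proof.
move=> hn hm w; elim: w d n hn => [|i w IHw] d n hn sw /=.
  case: d hn sw => [|d] hn sw; last by rewrite hn ?mul0r.
  by rewrite hm ?mulr0.
case: d hn sw => [|d] hn sw.
  by rewrite hm // mulr0 add0r conv0l // => s; apply: hn.
rewrite hn // mul0r add0r; apply: (IHw d) => // s sd; exact: hn.
Qed.

(** Homogeneity of [n] leaves only the cut after [s]. *)
Lemma conv_cat (R : comPzRingType) (d : nat) (n m : seq I -> R) s t :
  homogeneous_word d n -> size s = d -> conv n m (s ++ t) = n s * m t.
Proof.
move=> hn ds; rewrite -{d}ds in hn; elim: s n hn => [|i s IHs] n hn.
  by case: t => [|i t] //=; rewrite conv0l ?addr0 // => s; apply: hn.
rewrite /= hn // mul0r add0r IHs // => s' ss'.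
exact: hn.
Qed.

Lemma lie_word_hom e : homogeneous_word (lie_deg e) (lie_word e).
Proof.
elim: e => [i|e IHe f IHf] w /= sw.
  by case: (eqVneq w [:: i]) sw => // ->.
rewrite (conv_hom IHe IHf) // (conv_hom IHf IHe) ?subrr //.
by rewrite addnC.
Qed.

Lemma lie_word_brE e f s t : size s = lie_deg e -> size t = lie_deg f ->
  conv (lie_word e) (lie_word f) (s ++ t) = lie_word e s * lie_word f t.
Proof. by move=> ss st; rewrite (conv_cat _ _ (@lie_word_hom e)). Qed.

End LieWords.

Section LieSpan.
Variables (I : finType) (k : fieldType) (P : comAlgType k).
Implicit Types (e f : lie I) (s t w : seq I) (a b : P) (u v F G : seq I -> P).

(** The tensor product of [P] with the free Lie algebra, inside the words with coefficients in [P].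
    Only finite sums occur, which bounds the degree. *)
Inductive liespan : (seq I -> P) -> Prop :=
| lieSpan0 : liespan (fun=> 0)
| lieSpanD a e u : liespan u -> liespan (fun w => a * (lie_word k e w)%:A + u w).

Lemma liespan_lin a u v : liespan u -> liespan v ->
  liespan (fun w => a * u w + v w).
Proof.
elim=> {u} [|b e u _ IHu] hv.
  suff -> : (fun w => a * 0 + v w) = v by [].
  by apply/funext => w; rewrite mulr0 add0r.
suff -> : (fun w => a * (b * (lie_word k e w)%:A + u w) + v w) =
          (fun w => (a * b) * (lie_word k e w)%:A + (a * u w + v w)).
  exact: lieSpanD (IHu hv).
by apply/funext => w; ring.
Qed.

Lemma liespan_nil u : liespan u -> u [::] = 0.
Proof.
elim=> {u} // a e u _ ->; rewrite (@lie_word_hom I k e) ?scale0r ?mulr0 ?addr0 //.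
by rewrite eq_sym -lt0n lie_deg_gt0.
Qed.

Lemma liespan_bounded u : liespan u -> exists d, forall w, (d < size w)%N -> u w = 0.
Proof.
elim=> {u} [|a e u _ [d hd]]; first by exists 0.
exists (maxn (lie_deg e) d) => w; rewrite gtn_max => /andP[ew dw].
rewrite hd // (@lie_word_hom I k e) ?scale0r ?mulr0 ?addr0 //.
by rewrite neq_ltn ew orbT.
Qed.

Lemma wder_lin d a u v F w :
  wder d (fun s => a * u s + v s) F w = a * wder d u F w + wder d v F w.
Proof.
by rewrite /wder -wsum_lin; apply: eq_wsum => s _; ring.
Qed.

(** Contraction by a concatenation product is the composite of the two contractions, so commutators
    go to commutators. *)
Lemma wder_br e f F w :
  wder (lie_deg (LieBr e f)) (fun s => (lie_word k (LieBr e f) s)%:A) F w =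
  wder (lie_deg e) (fun s => (lie_word k e s)%:A)
    (wder (lie_deg f) (fun s => (lie_word k f s)%:A) F) w -
  wder (lie_deg f) (fun s => (lie_word k f s)%:A)
    (wder (lie_deg e) (fun s => (lie_word k e s)%:A) F) w.
Proof.
have H e1 f1 : wsum (lie_deg e1 + lie_deg f1)%N
    (fun s => (conv (lie_word k e1) (lie_word k f1) s)%:A * F (w ++ s)) =
  wder (lie_deg e1) (fun s => (lie_word k e1 s)%:A)
    (wder (lie_deg f1) (fun s => (lie_word k f1 s)%:A) F) w.
  rewrite wsum_cat; apply: eq_wsum => s ss; rewrite /wder -wsumZ.
  apply: eq_wsum => t st; rewrite lie_word_brE // catA mulrA.
  by congr (_ * _); rewrite -scalerAl mul1r scalerA.
rewrite -!H [X in _ - wsum X _]addnC -wsumB; apply: eq_wsum => s _ /=.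
by rewrite scalerBl mulrBl.
Qed.

Lemma eq_wder d u v F G : u =1 v -> F =1 G -> wder d u F =1 wder d v G.
Proof.
by move=> eu eF w; apply: eq_wsum => s _; rewrite eu eF.
Qed.

(** Removing a last letter is a derivation of the shuffle product, and commutators of derivations
    are derivations. *)
Lemma lie_word_derivation e :
  shuf_derivation (wder (lie_deg e) (fun s => (lie_word k e s)%:A : P)).
Proof.
elim: e => [i|e IHe f IHf] F G w.
  have H F' : wder 1 (fun s => (lie_word k (LieVar i) s)%:A) F' =1
              (fun s => F' (rcons s i)).
    move=> s; rewrite /wder /= (bigD1 i) //= eqxx scale1r mul1r cats1.
    rewrite big1 ?addr0 // => j ji.
    by rewrite eqseq_cons (negbTE ji) scale0r mul0r.
  rewrite H shuf_rcons.
  by congr (_ + _); apply: eq_shuf => // s; rewrite H.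
pose der e' := wder (lie_deg e') (fun s => (lie_word k e' s)%:A : P).
(* The two mixed terms are exchanged when [e1] and [f1] are, so they cancel in the commutator. *)
have D e1 f1 : shuf_derivation (der e1) -> shuf_derivation (der f1) ->
    der e1 (der f1 (shuf F G)) w =
    shuf (der e1 (der f1 F)) G w + shuf (der f1 F) (der e1 G) w
    + shuf (der e1 F) (der f1 G) w + shuf F (der e1 (der f1 G)) w.
  move=> h1 h2; rewrite -addrA -!h1 /der.
  rewrite /wder -wsumD; apply: eq_wsum => s _; rewrite -mulrDr; congr (_ * _).
  exact: h2.
rewrite wder_br -/(der e) -/(der f) D // D //.
rewrite (eq_shuf (wder_br e f F) (fun=> erefl)).
rewrite (eq_shuf (fun=> erefl) (wder_br e f G)) -/(der e) -/(der f).
have B1 F1 F2 G1 : shuf (fun s => F1 s - F2 s) G1 w = shuf F1 G1 w - shuf F2 G1 w.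
  rewrite -[in RHS]mulN1r addrC -shuf_linl; apply: eq_shuf => // s; ring.
have B2 F1 F2 G1 : shuf G1 (fun s => F1 s - F2 s) w = shuf G1 F1 w - shuf G1 F2 w.
  rewrite -[in RHS]mulN1r addrC -shuf_linr; apply: eq_shuf => // s; ring.
rewrite B1 B2; ring.
Qed.

(** Here [d] selects a homogeneous component of [u]: a Lie monomial of another degree contributes
    the zero contraction. *)
Lemma liespan_derivation d u : liespan u -> shuf_derivation (wder d u).
Proof.
elim=> {u} [|a e u _ IHu] F G w.
  have H F' : wder d (fun=> 0) F' =1 fun=> 0.
    by move=> s; apply: wsum0 => t _; rewrite mul0r.
  by rewrite H (eq_shuf (H F) (fun=> erefl)) (eq_shuf (fun=> erefl) (H G))
       shuf0l shuf0r addr0.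
have H F' : wder d (fun w => a * (lie_word k e w)%:A + u w) F' =1
   fun s => a * wder d (fun w => (lie_word k e w)%:A) F' s + wder d u F' s.
  by move=> s; apply: wder_lin.
rewrite H (eq_shuf (H F) (fun=> erefl)) (eq_shuf (fun=> erefl) (H G)).
rewrite shuf_linl shuf_linr IHu.
suff -> : wder d (fun w => (lie_word k e w)%:A) (shuf F G) w =
  shuf (wder d (fun w => (lie_word k e w)%:A) F) G w +
  shuf F (wder d (fun w => (lie_word k e w)%:A) G) w by ring.
have [->|de] := eqVneq d (lie_deg e); first exact: lie_word_derivation.
have {}H F' : wder d (fun w => (lie_word k e w)%:A) F' =1 fun=> 0.
  move=> s; apply: wsum0 => t st.
  by rewrite (@lie_word_hom I k e) ?st // scale0r mul0r.
by rewrite H (eq_shuf (H F) (fun=> erefl)) (eq_shuf (fun=> erefl) (H G))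
       shuf0l shuf0r addr0.
Qed.

End LieSpan.

(** * Left multiples among Lie polynomials *)

Section LeftMultiples.
Variables (I : finType) (k : fieldType) (P : comAlgType k).
Hypothesis char0 : [pchar k] =i pred0.
Hypothesis domP : forall a b : P, a * b = 0 -> a = 0 \/ b = 0.
Implicit Types (a b c : P) (u v w F G : seq I -> P) (s t : seq I).

Lemma natr_neq0 n : n.+1%:R != 0 :> k.
Proof. by rewrite (pcharf0P k).1. Qed.

Lemma natr_reg n (a : P) : n.+1%:R * a = 0 -> a = 0.
Proof.
move=> na0; rewrite -[a](scale1r a) -(mulVf (natr_neq0 n)) -scalerA.
by rewrite scaler_nat -[a *+ _]mulr_natl na0 scaler0.
Qed.

(** A contraction reads its argument on words longer by [d], so it is nilpotent on functionals of
    bounded support. *)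
Lemma wder_iter_small d v F l : (0 < d)%N ->
  (forall s, (l <= size s)%N -> F s = 0) ->
  forall j s, (l <= size s + j)%N -> iter j (wder d v) F s = 0.
Proof.
move=> d0 F0; elim=> [|j IHj] s /= ls; first by apply: F0; rewrite addn0 in ls.
apply: wsum0 => t td; rewrite IHj ?mulr0 // size_cat td.
by lia.
Qed.

(* Functionals killed by the right contraction by [v] separate the Lie elements
   of degree larger than [d]: subtracting from a multiple of [F] a shuffle
   product, on which the Lie element [u] vanishes, only changes [<u, F>] by a
   nonzero factor. *)
Lemma liespan_left_multiple (d m : nat) u v w a s0 :
  (0 < d)%N -> (0 < m)%N -> liespan u -> liespan v ->
  size s0 = d -> v s0 != 0 ->
  (forall s, size s = (m + d)%N -> a * u s = w (take m s) * v (drop m s)) ->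
  forall s, size s = (m + d)%N -> a * u s = 0.
Proof.
move=> d0 m0 uL vL s0d vs0 auwv.
have Du := liespan_derivation (m + d) uL.
have Dv := liespan_derivation d vL.
set c := v s0; pose lam s : P := (s == s0)%:R.
have lamD s : wder d v lam s = c * (s == [::])%:R.
  case: s => [|i s]; first by rewrite mulr1 /c -(wsum_single v s0d).
  rewrite mulr0; apply: wsum0 => t td; rewrite /lam.
  case: eqP => [E|]; last by rewrite mulr0.
  by move: s0d; rewrite -E /= size_cat td; lia.
have lamD2 F s : shuf (wder d v lam) F s = c * F s.
  by rewrite -shuf_unitl; apply: eq_shuf.
have iterE j F G : F =1 G -> iter j (wder d v) F =1 iter j (wder d v) G.
  by move=> e s; congr (iter _ _ _ _); apply/funext.
have leib j F s : iter j (wder d v) (shuf lam F) s =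
    shuf lam (iter j (wder d v) F) s + (j%:R * c) * iter j.-1 (wder d v) F s.
  elim: j s => [|j IHj] s; first by rewrite /= mul0r mul0r addr0.
  rewrite [LHS](eq_wder _ (fun=> erefl) IHj).
  transitivity (wder d v (shuf lam (iter j (wder d v) F)) s +
     j%:R * c * wder d v (iter j.-1 (wder d v) F) s).
    by rewrite addrC /wder -wsum_lin; apply: eq_wsum => t _; ring.
  rewrite Dv lamD2; case: j IHj => [|j] _ /=; ring.
have lin j b F G s : iter j (wder d v) (fun s => b * F s - G s) s =
   b * iter j (wder d v) F s - iter j (wder d v) G s.
  elim: j s => [|j IHj] s //=.
  rewrite (eq_wder _ (fun=> erefl) IHj) /wder -wsumZ -wsumB.
  by apply: eq_wsum => t _; ring.
pose pair F := wder (m + d) u F [::].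
(* Applied to the indicator of the word [s], this gives [a * u s = 0], since more than [m + d]
   contractions kill it. The induction is on the order of nilpotency of [F]. *)
suff pair0 j F : homogeneous_word (m + d)%N F ->
    (forall s, iter j.+1 (wder d v) F s = 0) -> a * pair F = 0.
  move=> s sd; have := pair0 (m + d)%N (fun t => (t == s)%:R).
  rewrite /pair /wder (wsum_single u sd); apply.
    by move=> t; case: (eqVneq t s) => [->|//]; rewrite sd eqxx.
  move=> t; apply: (@wder_iter_small d v _ (m + d).+1) => // [t' |]; last by lia.
  by case: (eqVneq t' s) => [->|//]; rewrite sd ltnn.
elim: j F => [|j IHj] F hF DF.
  (* When [F] is killed by [v], pairing it with the product of [w] and [v] gives [w] paired with
     zero. *)
  rewrite /pair /wder -wsumZ.
  transitivity (wsum (m + d)%N (fun s => w (take m s) * v (drop m s) * F s)).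
    by apply: eq_wsum => s sd; rewrite mulrA auwv.
  rewrite wsum_cat; apply: wsum0 => s ss.
  rewrite -[RHS](mulr0 (w s)) -[X in _ = w s * X](DF s) /= /wder -wsumZ.
  by apply: eq_wsum => t _; rewrite -ss take_size_cat // drop_size_cat // mulrA.
(* The coefficient is the one that the Leibniz rule for [lam] produces, so that [G] is killed by one
   contraction fewer than [F]. *)
pose G s := j.+1%:R * c * F s - shuf lam (wder d v F) s.
have DvF : homogeneous_word m (wder d v F).
  move=> s sm; apply: wsum0 => t td; rewrite hF ?mulr0 // size_cat td.
  by rewrite eqn_add2r.
have Ghom : homogeneous_word (m + d)%N G.
  move=> s ss; rewrite /G hF // mulr0 sub0r.
  rewrite (@shuf_hom _ _ d m) ?oppr0 //; last by rewrite addnC.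
  by move=> t; rewrite /lam; case: (eqVneq t s0) => [->|//]; rewrite s0d eqxx.
have GD s : iter j.+1 (wder d v) G s = 0.
  rewrite (lin _ (j.+1%:R * c)) leib.
  have -> : shuf lam (iter j.+1 (wder d v) (wder d v F)) s = 0.
    rewrite -(shuf0r lam s); apply: eq_shuf => // t.
    by rewrite -iterSr DF.
  by rewrite add0r -!iterSr /= subrr.
have := IHj _ Ghom GD.
have -> : pair G = j.+1%:R * c * pair F.
  rewrite {1}/pair.
  transitivity (j.+1%:R * c * wder (m + d) u F [::]
                - wder (m + d) u (shuf lam (wder d v F)) [::]).
    by rewrite /wder -wsumZ -wsumB; apply: eq_wsum => t _; rewrite /G; ring.
  (* As a derivation, [u] kills a shuffle product of two functionals that vanish on the empty word;
     [d > 0] and [m > 0] provide this for both factors. *)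
  rewrite Du /= [lam [::]](_ : _ = 0) ?mul0r ?addr0; last first.
    by rewrite /lam; move: s0d d0; case: s0 {vs0 c lam lamD lamD2 leib G Ghom GD} => //= <-.
  by rewrite DvF ?mulr0 ?subr0 // eq_sym -lt0n.
rewrite mulrCA -mulrA => /natr_reg/domP [c0|//].
by rewrite /c in c0; rewrite c0 eqxx in vs0.
Qed.

End LeftMultiples.

(** * Left modules over the Poisson enveloping algebra *)

Section LeftModule.
Variables (I : finType) (k : fieldType) (P : comAlgType k) (D : I -> P -> P).
Hypothesis char0 : [pchar k] =i pred0.
Hypothesis domP : forall a b : P, a * b = 0 -> a = 0 \/ b = 0.
Hypothesis D_add : forall i a b, D i (a + b) = D i a + D i b.
Hypothesis D_mul : forall i a b, D i (a * b) = D i a * b + a * D i b.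
Implicit Types (a b c : P) (u v w al be : seq I -> P) (s t : seq I) (i j : I).

Definition letter i s : P := (s == [:: i])%:R.

(* The action of the generator [x_i] of the Poisson enveloping algebra on the
   words with coefficients in [P], for [D i = {x_i, -}]. *)
Definition hact i w s : P :=
  D i (w s) + (if s is j :: s' then (i == j)%:R * w s' else 0).

Lemma D0 i : D i 0 = 0.
Proof. by apply: (addrI (D i 0)); rewrite -D_add !addr0. Qed.

(** The element of the enveloping algebra with coefficient [al t] to the left of the word [t],
    applied to [w]; last letters act first. Words longer than [m] are ignored. *)
Fixpoint act m al w s : P :=
  al [::] * w s +
  (if m is m'.+1 then \sum_i act m' (fun t => al (rcons t i)) (hact i w) s else 0).

Lemma actS m al w s : act m.+1 al w s =
  al [::] * w s + \sum_i act m (fun t => al (rcons t i)) (hact i w) s.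
Proof. by []. Qed.

Lemma eq_act m al be u v : al =1 be -> u =1 v -> act m al u =1 act m be v.
Proof.
by move=> /funext -> /funext ->.
Qed.

Lemma act_lin m a al be w s :
  act m (fun t => a * al t + be t) w s = a * act m al w s + act m be w s.
Proof.
elim: m al be w s => [|m IHm] al be w s /=; first by ring.
rewrite (eq_bigr _ (fun i _ => IHm _ _ _ _)) big_split -mulr_sumr /=.
by ring.
Qed.

Lemma act0 m al w s : (forall t, al t = 0) -> act m al w s = 0.
Proof.
elim: m al w s => [|m IHm] al w s al0 /=; rewrite al0 mul0r add0r //.
by apply: big1 => i _; rewrite IHm.
Qed.

Lemma actZ m a al w s : act m (fun t => a * al t) w s = a * act m al w s.
Proof.
rewrite -[RHS]addr0 -(act0 m (al := fun=> 0) w s) // -act_lin.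
by apply: eq_act => // t; rewrite addr0.
Qed.

Lemma act_const m c w s : act m (fun t => c * (t == [::])%:R) w s = c * w s.
Proof.
case: m => [|m] /=; rewrite mulr1 ?addr0 //.
rewrite big1 ?addr0 // => i _; apply: act0 => t.
by rewrite -size_eq0 size_rcons mulr0.
Qed.

Definition bounded (d : nat) w := forall s, (d < size s)%N -> w s = 0.

Lemma act_widen m n al w s : bounded m al -> (m <= n)%N ->
  act n al w s = act m al w s.
Proof.
elim: m n al w s => [|m IHm] [|n] al w s bal //= le.
  rewrite addr0 big1 ?addr0 // => i _.
  by apply: act0 => t; apply: bal; rewrite size_rcons.
congr (_ + _); apply: eq_bigr => i _; apply: IHm => // t mt.
by apply: bal; rewrite size_rcons.
Qed.

Lemma hact_lin i (J : finType) (F : J -> seq I -> P) w s a :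
  hact i (fun t => a * w t + \sum_j F j t) s =
    D i a * w s + a * hact i w s + \sum_j hact i (F j) s.
Proof.
have Dsum (g : J -> P) : D i (\sum_j g j) = \sum_j D i (g j).
  by elim/big_rec2: _ => [|j x y _ <-]; rewrite ?D0 ?D_add.
rewrite /hact D_add D_mul Dsum big_split /= .
case: s => [|j s]; first by rewrite [X in _ = _ + (_ + X)]big1_eq; ring.
by rewrite mulrDr mulr_sumr; ring.
Qed.

Lemma hact_nil i w : hact i w [::] = D i (w [::]).
Proof. by rewrite /hact addr0. Qed.

(** Associativity: the coefficients [al] are themselves words over [P], and left multiplication by a
    generator acts on them as [hact]. *)
Lemma hact_act m i al w s : bounded m al ->
  hact i (act m al w) s = act m.+1 (hact i al) w s.
Proof.
elim: m al w s => [|m IHm] al w s bal.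
  rewrite (_ : act 0 al w = fun s => al [::] * w s + \sum_(j : 'I_0) 0); last first.
    by apply/funext => t; rewrite big_ord0.
  rewrite (hact_lin i (fun (j : 'I_0) (s : seq I) => 0)) big_ord0 addr0 [RHS]/= hact_nil.
  congr (_ + _); rewrite (bigD1 i) //= big1 => [|j ji].
    by rewrite !addr0 [hact i al _]/hact (bal [:: i]) // D0 eqxx mul1r add0r.
  by rewrite [hact i al _]/hact (bal [:: j]) // D0 eq_sym (negbTE ji) mul0r !addr0 mul0r.
rewrite (_ : act m.+1 al w = fun s => al [::] * w s + 
   \sum_j act m (fun t => al (rcons t j)) (hact j w) s) //.
rewrite hact_lin.
rewrite [RHS]actS hact_nil -addrA; congr (_ + _).
have E j : act m.+1 (fun t => hact i al (rcons t j)) (hact j w) s =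
   (i == j)%:R * al [::] * hact j w s + hact i (act m (fun t => al (rcons t j)) (hact j w)) s.
  rewrite IHm; last by move=> t mt; apply: bal; rewrite size_rcons.
  rewrite -(act_const m.+1) -[X in X + _]mul1r -act_lin.
  apply: eq_act => // -[|l t] /=; rewrite /hact /=; ring.
rewrite [RHS](eq_bigr _ (fun j _ => E j)) [RHS]big_split /=; congr (_ + _).
rewrite (bigD1 i) //= big1 ?addr0 => [|j ji]; first by rewrite eqxx mul1r.
by rewrite eq_sym (negbTE ji) !mul0r.
Qed.

Lemma hact_bounded i d w : bounded d w -> bounded d.+1 (hact i w).
Proof.
move=> bw [|j s] // ds; rewrite /hact !bw ?D0 ?mulr0 ?addr0 //.
exact: ltnW.
Qed.

(** The terms with [D] do not lengthen words, so in the highest total degree only concatenation is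
    left. *)
Lemma act_top m n d al w p s : bounded m al -> (m <= n)%N -> bounded d w ->
  size p = m -> size s = d -> act n al w (p ++ s) = al p * w s.
Proof.
move=> bal mn bw pm sd; rewrite (act_widen _ _ bal) // => {n mn}.
elim: m al w p s d bal bw pm sd => [|m IHm] al w p s d bal bw pm sd.
  by case: p pm => //= _; rewrite addr0.
case/lastP: p pm => [//|p j]; rewrite size_rcons => -[pm] /=.
rewrite bw ?mulr0 ?add0r; last by rewrite size_cat size_rcons; lia.
transitivity (\sum_i al (rcons p i) * hact i w (j :: s)).
  apply: eq_bigr => i _; rewrite cat_rcons.
  apply: (IHm (fun t => al (rcons t i)) _ _ _ d.+1) => //; last by rewrite /= sd.
    by move=> t mt; apply: bal; rewrite size_rcons.
  exact: hact_bounded.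
rewrite (bigD1 j) //= big1 ?addr0 => [|i ij].
  by rewrite /hact bw /= ?sd // D0 add0r eqxx mul1r.
by rewrite /hact bw /= ?sd // D0 add0r (negbTE ij) mul0r mulr0.
Qed.

(** [SubDiv] stands in for an extension of scalars to the fraction field of [P]. *)
Inductive submodule w1 w2 : (seq I -> P) -> Prop :=
| SubL : submodule w1 w2 w1
| SubR : submodule w1 w2 w2
| SubLin a u v of submodule w1 w2 u & submodule w1 w2 v :
    submodule w1 w2 (fun s => a * u s + v s)
| SubAct i u of submodule w1 w2 u : submodule w1 w2 (hact i u)
| SubDiv c u of c <> 0 & submodule w1 w2 (fun s => c * u s) : submodule w1 w2 u.

Lemma submodule_sym w1 w2 u : submodule w1 w2 u -> submodule w2 w1 u.
Proof.
elim=> {u} [||a u v _ + _|i u _|c u c0 _].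
- exact: SubR.
- exact: SubL.
- exact: SubLin.
- exact: SubAct.
- exact: SubDiv.
Qed.

Lemma submodule_sub w1 w2 w3 u : submodule w1 w3 w2 ->
  submodule w1 w2 u -> submodule w1 w3 u.
Proof.
move=> w2T; elim=> {u} [||a u v _ + _|i u _|c u c0 _] //.
- exact: SubL.
- exact: SubLin.
- exact: SubAct.
- exact: SubDiv.
Qed.

Lemma submoduleP w1 w2 u : submodule w1 w2 u ->
  exists c m al be, [/\ c <> 0, bounded m al, bounded m be
    & forall s, c * u s = act m al w1 s + act m be w2 s].
Proof.
have one0 : (1 : P) <> 0 by apply/eqP; rewrite oner_eq0.
have mul0 a b : a <> 0 -> b <> 0 -> a * b <> 0 by move=> a0 b0 /domP[].
have bounded0 m : bounded m (fun=> 0) by [].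
have boundedlin m n a b al be : bounded m al -> bounded n be ->
    bounded (m + n) (fun s => a * al s + b * be s).
  by move=> bal bbe s ls; rewrite bal ?bbe ?mulr0 ?addr0 //; lia.
have boundedc : bounded 0 (fun s => 1 * (s == [::])%:R).
  by move=> [|i s] // _; rewrite mulr0.
have one m w s : act m (fun s => 1 * (s == [::])%:R) w s = w s.
  by rewrite act_const mul1r.
elim=> {u} [||a u v _ [c [m [al [be [c0 bal bbe cu]]]]]
    _ [c' [m' [al' [be' [c'0 bal' bbe' cv]]]]]
  |i u _ [c [m [al [be [c0 bal bbe cu]]]]]|c u c0 _ [c' [m [al [be [c'0 bal bbe cu]]]]]].
- exists 1, 0%N, (fun s => 1 * (s == [::])%:R), (fun=> 0); split=> // s.
  by rewrite one act0 // addr0 mul1r.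
- exists 1, 0%N, (fun=> 0), (fun s => 1 * (s == [::])%:R); split=> // s.
  by rewrite one act0 // add0r mul1r.
- exists (c * c'), (m + m')%N, (fun s => (c' * a) * al s + c * al' s),
    (fun s => (c' * a) * be s + c * be' s).
  split; [exact: mul0 | exact: boundedlin | exact: boundedlin|] => s.
  have lin al1 al2 w : bounded m al1 -> bounded m' al2 ->
      act (m + m') (fun s => (c' * a) * al1 s + c * al2 s) w s =
      (c' * a) * act m al1 w s + c * act m' al2 w s.
    move=> b1 b2; rewrite act_lin -(act_widen (n := m + m') _ _ b1) ?leq_addr //.
    rewrite -(act_widen (n := m + m') _ _ b2) ?leq_addl //; congr (_ + _).
    exact: actZ.
  rewrite !lin // addrACA -!mulrDr -cu -cv; ring.
(* The generator [x_i] does not commute with the denominator: [x_i (c u) = c x_i u + D i c u].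
   Multiplying by [c] expresses [c ^ 2 x_i u] through [c u]. *)
- exists (c * c), m.+1, (fun s => c * hact i al s + (- D i c) * al s),
     (fun s => c * hact i be s + (- D i c) * be s).
  have b2 al1 : bounded m al1 -> bounded m.+1 (fun s => c * hact i al1 s + - D i c * al1 s).
    move=> b1 s ls; rewrite (hact_bounded i b1) // b1 ?mulr0 ?addr0 //; lia.
  split; [exact: mul0 | exact: b2 | exact: b2|] => s.
  have lin al1 w : bounded m al1 -> act m.+1 (fun s => c * hact i al1 s + - D i c * al1 s) w s
     = c * hact i (act m al1 w) s - D i c * act m al1 w s.
    move=> b1; rewrite act_lin hact_act //; congr (_ + _).
    by rewrite actZ (act_widen _ _ b1) // mulNr.
  rewrite !lin // addrACA -mulrDr -opprD -mulrDr -cu.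
  have -> : hact i (act m al w1) s + hact i (act m be w2) s = hact i (fun s => c * u s) s.
    rewrite (_ : (fun s => c * u s) = (fun s => act m al w1 s + act m be w2 s)); last first.
      by apply/funext.
    by rewrite /hact D_add; case: (s) => [|j s0]; ring.
  by rewrite /hact D_mul; case: (s) => [|j s0]; ring.
- exists (c' * c), m, al, be; split=> // [|s]; first exact: mul0.
  by rewrite -mulrA cu.
Qed.

End LeftModule.

(** * Pairs of Lie elements that generate all letters *)

Section DegreeReduction.
Variables (I : finType) (k : fieldType) (P : comAlgType k) (D : I -> P -> P).
Hypothesis char0 : [pchar k] =i pred0.
Hypothesis domP : forall a b : P, a * b = 0 -> a = 0 \/ b = 0.
Hypothesis D_add : forall i a b, D i (a + b) = D i a + D i b.
Hypothesis D_mul : forall i a b, D i (a * b) = D i a * b + a * D i b.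
Implicit Types (a b c : P) (u v w al be : seq I -> P) (s t : seq I) (i j : I).
Variables i0 i1 : I.
Hypothesis i01 : i0 != i1.

Lemma bounded_step d w : bounded d.+1 w -> (forall s, size s = d.+1 -> w s = 0) ->
  bounded d w.
Proof.
move=> bw w0 s ds; have [/bw//|] := ltnP d.+1 (size s).
by move=> le; apply: w0; lia.
Qed.

Lemma liespan_bounded0 w : liespan w -> bounded 0 w -> forall s, w s = 0.
Proof.
move=> wL bw [|i s]; last exact: bw.
exact: liespan_nil wL.
Qed.

Lemma act_eq0r m al w s : (forall t, w t = 0) -> act D m al w s = 0.
Proof.
elim: m al w s => [|m IHm] al w s w0 /=; rewrite w0 mulr0 add0r //.
apply: big1 => i _; apply: IHm => -[|j t]; rewrite /hact w0 (D0 D_add) ?addr0 //.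
by rewrite w0 mulr0 addr0.
Qed.

(* Stated without [N - d], as [al] has to vanish when [N < d]. *)
Definition cobounded (N d : nat) al := forall s, (N < size s + d)%N -> al s = 0.

(** The form of [act_top] used for cancellations: only the total degree is bounded, and the test
    keeps the truncated [N - d] from producing a spurious term. *)
Lemma act_cotop N d m al w q : bounded m al -> cobounded N d al -> bounded d w ->
  (size q = N)%N -> act D m al w q =
  if (d <= N)%N then al (take (N - d) q) * w (drop (N - d) q) else 0.
Proof.
move=> bal cal bw qN; case: leqP => dN; last first.
  by apply: act0 => t; apply: cal; lia.
have bal' : bounded (N - d) al by move=> s ls; apply: cal; lia.
have M : act D (maxn m (N - d)) al w q = act D m al w q.
  by apply: act_widen => //; rewrite leq_maxl.
rewrite -M -{1}(cat_take_drop (N - d) q).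
apply: (act_top D_add bal') => //.
- by rewrite leq_maxr.
- by rewrite size_drop qN subKn.
- by rewrite size_take; case: ltnP; lia.
Qed.

(** A degree count makes [w] linear and the multipliers scalar; one linear form cannot be
    proportional to two distinct letters. *)
Lemma letter_not_multiple d w : bounded d w -> w [::] = 0 ->
  (forall i, exists c m al, [/\ c <> 0, bounded m al &
     forall s, c * letter P i s = act D m al w s]) -> False.
Proof.
move=> + w00; elim: d => [|d IHd] bw H.
  have [c [m [al [c0 _ E]]]] := H i0.
  have := E [:: i0]; rewrite act_eq0r ?/letter ?eqxx ?mulr1 //.
  by move=> [|i s] //; apply: bw.
have [w0|] := pselect (forall s, size s = d.+1 -> w s = 0).
  exact: IHd (bounded_step bw w0) H.
move=> /existsNP[s1 /not_implyP[s1d ws1]].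
have {}H i : exists2 c, c <> 0 & exists m al, [/\ bounded m al, cobounded 1 d.+1 al
   & forall s, c * letter P i s = act D m al w s].
  have [c [m [al [c0 bal E]]]] := H i; exists c => //; exists m, al.
  split=> // {H}.
  (* The letter vanishes in degree [N.+2], hence so does the product of top parts there, and a
     nonzero coefficient of [w] can be cancelled. *)
  suff H N : cobounded N.+1 d.+1 al -> cobounded 1 d.+1 al.
    by apply: (H (m + d.+1)%N) => s ls; apply: bal; lia.
  elim: N => // N IHN cal; apply: IHN => s ls.
  have [|le] := ltnP N.+2 (size s + d.+1); first exact: cal.
  have sz : (size s = N.+2 - d.+1)%N by lia.
  have := E (s ++ s1).
  rewrite (act_cotop bal cal bw) ?size_cat ?s1d; last by lia.
  rewrite -sz take_size_cat // drop_size_cat // [(d < N.+2)%N](_ : _ = true); last by lia.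
  have -> : letter P i (s ++ s1) = 0.
    rewrite /letter; case: eqP => // E'; have := congr1 size E'.
    by rewrite size_cat s1d /=; lia.
  by rewrite mulr0 => /esym/domP[].
(* If [w] has degree at least 2, total degree 1 leaves no coefficient at all. Otherwise only the
   constant coefficient is left. *)
case: d IHd bw s1d H => [|d] IHd bw s1d H; last first.
  have [c c0 [m [al [bal cal E]]]] := H i0.
  apply: c0; have := E [:: i0]; rewrite /letter eqxx mulr1 act0 // => s.
  by apply: cal; lia.
have A i j : i != j -> w [:: j] = 0.
  move=> ij; have [c c0 [m [al [bal cal E]]]] := H i.
  have := E [:: i]; rewrite (act_cotop bal cal bw) //= /letter eqxx mulr1 => ca.
  have := E [:: j]; rewrite (act_cotop bal cal bw) //= /letter.
  rewrite eqseq_cons eq_sym (negbTE ij) mulr0 => /esym/domP[a0|//].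
  by case: c0; rewrite ca a0 mul0r.
apply: ws1; case: s1 s1d => [|j [|j' s]] // _.
have [->|] := eqVneq j i0; last by rewrite eq_sym => /A.
by apply: (A i1); rewrite eq_sym.
Qed.

(* The elements [w1] and [w2] have degree at most 1 if the submodule that they
   generate contains all letters: otherwise a relation between their leading
   parts makes one of them a left multiple of the other one. *)
Theorem liespan_letters d1 d2 w1 w2 :
  liespan w1 -> liespan w2 -> bounded d1.+1 w1 -> bounded d2.+1 w2 ->
  (forall i, submodule D w1 w2 (letter P i)) -> bounded 1 w1 /\ bounded 1 w2.
Proof.
have [n le] := ubnP (d1 + d2); elim: n d1 d2 w1 w2 le => // n IHn d1 d2 w1 w2 le.
wlog d12 : d1 d2 w1 w2 le / (d1 <= d2)%N => [H|] w1L w2L bw1 bw2 T.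
  have [d12|d21] := leqP d1 d2; first exact: (H d1 d2).
  suff [] : bounded 1 w2 /\ bounded 1 w1 by [].
  apply: (H d2 d1) => //; [by rewrite addnC|exact: ltnW|].
  by move=> i; apply: submodule_sym.
case: d2 le d12 bw2 => [|d2] le d12 bw2.
  by move: d12; rewrite leqn0 => /eqP d10; rewrite d10 in bw1.
have [w20|] := pselect (forall s, size s = d2.+2 -> w2 s = 0).
  by apply: (IHn d1 d2) => //; [move: le; rewrite addnS|apply: bounded_step].
move=> /existsNP[s2 /not_implyP[s2d ws2]].
(* A Lie element of degree 0 is zero, and the other generator alone cannot produce two letters. *)
have one_gen w w' : liespan w -> liespan w' -> bounded 0 w ->
   (forall i, submodule D w w' (letter P i)) -> False.
  move=> wL w'L bw T'; have [d bw'] := liespan_bounded w'L.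
  apply: (letter_not_multiple bw' (liespan_nil w'L)) => i.
  have [c [m [al [be [c0 _ bbe E]]]]] := submoduleP domP D_add D_mul (T' i).
  exists c, m, be; split=> // s; rewrite E act_eq0r ?add0r //.
  exact: liespan_bounded0.
have [w10|] := pselect (forall s, size s = d1.+1 -> w1 s = 0).
  case: d1 le d12 bw1 w10 => [|d1] le d12 bw1 w10.
    by case: (one_gen w1 w2) => //; apply: bounded_step.
  by apply: (IHn d1 d2.+1) => //; apply: bounded_step.
move=> /existsNP[s1 /not_implyP[s1d ws1]].
pose rel N al be := [/\ cobounded N d1.+1 al, cobounded N d2.+2 be
  & forall q, size q = N ->
    (if (d1 < N)%N then al (take (N - d1.+1) q) * w1 (drop (N - d1.+1) q) else 0)
  + (if (d2.+1 < N)%N then be (take (N - d2.+2) q) * w2 (drop (N - d2.+2) q) else 0) = 0].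
(* Without a nontrivial relation of leading parts in degree at least 2, the coefficients that
   express a letter descend to total degree 1. Then [be] vanishes, as [w2] has degree at least 2,
   and every letter comes from [w1] alone. *)
have [NC|] := pselect (forall N al be, rel N.+2 al be ->
   cobounded N.+1 d1.+1 al /\ cobounded N.+1 d2.+2 be).
  exfalso.
  apply: (letter_not_multiple bw1 (liespan_nil w1L)) => i.
  have [c [m [al [be [c0 bal bbe E]]]]] := submoduleP domP D_add D_mul (T i).
  exists c, m, al; split=> // s; rewrite E.
  suff H N : cobounded N.+1 d1.+1 al -> cobounded N.+1 d2.+2 be -> cobounded 1 d2.+2 be.
    rewrite [X in _ + X]act0 ?addr0 // => t.
    apply: (H (m + d1.+1 + d2.+2)%N); [move=> s' ls..|by lia].
      by apply: bal; lia.
    by apply: bbe; lia.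
  elim: N => // N IHN cal cbe.
  have [] := NC N al be; last exact: IHN.
  split=> // q qN; rewrite -(act_cotop bal cal bw1 qN) -(act_cotop bbe cbe bw2 qN) -E.
  by rewrite /letter; case: eqP qN => [->|_]; rewrite ?mulr0.
move=> /existsNP[N /existsNP[al /existsNP[be /not_implyP[[cal cbe rel0] nz]]]].
have al0 : (forall q, size q = N.+2 ->
   (if (d1 < N.+2)%N then al (take (N.+2 - d1.+1) q) * w1 (drop (N.+2 - d1.+1) q) else 0) = 0) ->
   cobounded N.+1 d1.+1 al.
  move=> H s ls; have [|le'] := ltnP N.+2 (size s + d1.+1); first exact: cal.
  have := H (s ++ s1); rewrite size_cat s1d.
  have sz : (size s = N.+2 - d1.+1)%N by lia.
  rewrite -sz take_size_cat // drop_size_cat // [(d1 < _)%N](_ : _ = true); last by lia.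
  by move=> {}/(_ _)/domP[|//|//]; lia.
(* If all top coefficients of [be] vanished, those of [al] would vanish too, and the relation would
   be trivial. *)
have [p pN bep] : exists2 p, (size p + d2.+2 = N.+2)%N & be p <> 0.
  apply: contrapT => nbe; apply: nz.
  have be0 p : (size p + d2.+2 = N.+2)%N -> be p = 0.
    by move=> sp; apply: contrapT => bp; apply: nbe; exists p.
  split; last first.
    move=> s ls; have [|le'] := ltnP N.+2 (size s + d2.+2); first exact: cbe.
    by apply: be0; lia.
  apply: al0 => q qN; rewrite -[RHS](rel0 q qN).
  case: (ltnP d2.+1 N.+2) => dN; last by rewrite addr0.
  rewrite (be0 (take _ q)) ?mul0r ?addr0 // size_take qN.
  by case: ltnP; lia.
have pE : (N.+2 - d2.+2 = size p)%N by lia.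
(* Reading the relation on the words that begin with [p] makes a multiple of the leading part of
   [w2] a left multiple of that of [w1]. *)
have {}rel0 s : size s = d2.+2 -> be p * w2 s +
    al (p ++ take (d2.+1 - d1) s) * w1 (drop (d2.+1 - d1) s) = 0.
  move=> sd; have := rel0 (p ++ s); rewrite size_cat sd pN => /(_ erefl).
  rewrite pE (take_size_cat _ (erefl (size p))) (drop_size_cat _ (erefl (size p))).
  have -> : (N.+2 - d1.+1 = size p + (d2.+1 - d1))%N by lia.
  have -> : (d1 < N.+2)%N by lia.
  have -> : (d2.+1 < N.+2)%N by lia.
  by rewrite take_cat drop_cat ltnNge leq_addr /= addKn addrC.
have [dlt|dge] := ltnP d1 d2.+1.
  have e21 : (d2.+2 = (d2.+1 - d1) + d1.+1)%N by lia.
  have := @liespan_left_multiple _ _ _ char0 domP d1.+1 (d2.+1 - d1) w2 w1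
    (fun t => - al (p ++ t)) (be p) s1 isT.
  rewrite -e21 => /(_ _ _ _ _ _ _ s2 s2d)/domP[] //; first by lia.
    exact/eqP.
  by move=> s /rel0/eqP; rewrite addr_eq0 mulNr => /eqP.
have d1E : d1 = d2.+1 by lia.
(* In equal degrees the multiplier is a scalar of [P]: the combination loses its leading part, and
   [SubDiv] gives back [w2]. *)
pose w2' s := be p * w2 s + al p * w1 s.
have w2'L : liespan w2'.
  apply: liespan_lin => //.
  suff -> : (fun s => al p * w1 s) = (fun s => al p * w1 s + 0).
    exact: liespan_lin w1L (lieSpan0 _ _).
  by apply/funext => s; rewrite addr0.
have bw2' : bounded d2.+1 w2'.
  apply: bounded_step => [s ls|s sd].
    by rewrite /w2' bw2 // bw1 ?mulr0 ?addr0 // d1E.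
  have := rel0 s sd; rewrite d1E subnn take0 drop0 cats0.
  by [].
have [] := IHn d1 d2 w1 w2' _ w1L w2'L bw1 bw2'; first by lia.
  move=> i; apply: (submodule_sub _ (T i)).
  apply: (SubDiv (c := be p)) => //.
  rewrite (_ : (fun s => _) = (fun s => - al p * w1 s + w2' s)); last first.
    by apply/funext => s; rewrite /w2'; ring.
  by apply: SubLin; [apply: SubL | apply: SubR].
move=> b1 b2'; split=> // s ls.
have := b2' s ls; rewrite /w2' (b1 s ls) mulr0 addr0.
by case/domP.
Qed.

End DegreeReduction.

(** * Identities for Poisson brackets *)

Section PoissonTheory.
Variables (k : fieldType) (Q : poissonAlgType k).
Implicit Types x y z : Q.

Lemma bracketDl x y z : bracket (x + y) z = bracket x z + bracket y z.
Proof. by have := bracket_linearl 1 x y z; rewrite !scale1r. Qed.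

Lemma bracketDr x y z : bracket x (y + z) = bracket x y + bracket x z.
Proof. by have := bracket_linearr 1 x y z; rewrite !scale1r. Qed.

Lemma bracket0r x : bracket x 0 = 0.
Proof. by apply: (addrI (bracket x 0)); rewrite -bracketDr !addr0. Qed.

Lemma bracketNr x y : bracket x (- y) = - bracket x y.
Proof. by apply: (addrI (bracket x y)); rewrite -bracketDr !subrr bracket0r. Qed.

Lemma bracketZr a x y : bracket x (a *: y) = a *: bracket x y.
Proof. by rewrite -[a *: y]addr0 bracket_linearr bracket0r addr0. Qed.

Lemma bracketC x y : bracket x y = - bracket y x.
Proof.
apply/eqP; rewrite -addr_eq0; apply/eqP.
have := bracketxx (x + y); rewrite bracketDl !bracketDr !bracketxx.
by rewrite add0r addr0.
Qed.

Lemma bracketMl x y z : bracket (x * y) z = bracket x z * y + x * bracket y z.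
Proof.
by rewrite bracketC bracket_leibniz (bracketC z x) (bracketC z y); ring.
Qed.

Lemma bracket1r x : bracket x 1 = 0.
Proof.
have := bracket_leibniz x 1 1; rewrite !mulr1 mul1r => E.
by apply: (addrI (bracket x 1)); rewrite addr0 -E.
Qed.

Lemma bracket_alg_r x (a : k) : bracket x a%:A = 0.
Proof. by rewrite bracketZr bracket1r scaler0. Qed.

Lemma bracket_alg_l x (a : k) : bracket a%:A x = 0.
Proof. by rewrite bracketC bracket_alg_r oppr0. Qed.

Lemma jacobi_der x y z :
  bracket x (bracket y z) = bracket (bracket x y) z + bracket y (bracket x z).
Proof.
apply/eqP; rewrite -subr_eq0 -[X in _ == X](bracket_jacobi x y z); apply/eqP.
rewrite (bracketC (bracket x y) z) (bracketC z x) bracketNr; ring.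
Qed.

End PoissonTheory.

(** * The extension of a Poisson algebra by words *)

Section Extension.
Variables (k : fieldType) (Q : poissonAlgType k) (I : finType).
Implicit Types (n m : seq I -> Q) (p q : Q) (w : seq I).

(* The split extension of [Q] by the Poisson module of words with coefficients
   in [Q], with square-zero multiplication, and the commutator of words. *)
Record pext := Pext { pbase : Q; pword : seq I -> Q }.
Implicit Types x y z : pext.

HB.instance Definition _ := gen_eqMixin pext.
HB.instance Definition _ := gen_choiceMixin pext.

Lemma pextP x y : pbase x = pbase y -> pword x =1 pword y -> x = y.
Proof. by case: x y => [p n] [q m] /= -> /funext ->. Qed.

Definition pext_zero := Pext 0 (fun=> 0).
Definition pext_opp x := Pext (- pbase x) (fun w => - pword x w).
Definition pext_add x y := Pext (pbase x + pbase y) (fun w => pword x w + pword y w).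
Definition pext_one := Pext 1 (fun=> 0).
Definition pext_mul x y := Pext (pbase x * pbase y)
  (fun w => pbase x * pword y w + pbase y * pword x w).
Definition pext_scale (a : k) x := Pext (a *: pbase x) (fun w => a *: pword x w).
Definition pext_bracket x y := Pext (bracket (pbase x) (pbase y))
  (fun w => bracket (pbase x) (pword y w) - bracket (pbase y) (pword x w)
     + (conv (pword x) (pword y) w - conv (pword y) (pword x) w)).

Let pext_addA : associative pext_add.
Proof. by move=> x y z; apply: pextP => [|w] /=; rewrite addrA. Qed.
Let pext_addC : commutative pext_add.
Proof. by move=> x y; apply: pextP => [|w] /=; rewrite addrC. Qed.
Let pext_add0 : left_id pext_zero pext_add.
Proof. by move=> x; apply: pextP => [|w] /=; rewrite add0r. Qed.
Let pext_addN : left_inverse pext_zero pext_opp pext_add.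
Proof. by move=> x; apply: pextP => [|w] /=; rewrite addNr. Qed.

HB.instance Definition _ :=
  GRing.isZmodule.Build pext pext_addA pext_addC pext_add0 pext_addN.

Let pext_mulA : associative pext_mul.
Proof. by move=> x y z; apply: pextP => [|w] /=; ring. Qed.
Let pext_mulC : commutative pext_mul.
Proof. by move=> x y; apply: pextP => [|w] /=; ring. Qed.
Let pext_mul1 : left_id pext_one pext_mul.
Proof. by move=> x; apply: pextP => [|w] /=; ring. Qed.
Let pext_mulDl : left_distributive pext_mul pext_add.
Proof. by move=> x y z; apply: pextP => [|w] /=; ring. Qed.
Let pext_one_neq0 : pext_one != pext_zero.
Proof.
by apply/eqP => /(congr1 pbase) /= /eqP; rewrite oner_eq0.
Qed.

HB.instance Definition _ := GRing.Zmodule_isComNzRing.Build pext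
  pext_mulA pext_mulC pext_mul1 pext_mulDl pext_one_neq0.

Let pext_scaleA a b x : pext_scale a (pext_scale b x) = pext_scale (a * b) x.
Proof. by apply: pextP => [|w] /=; rewrite scalerA. Qed.
Let pext_scale1 : left_id 1 pext_scale.
Proof. by move=> x; apply: pextP => [|w] /=; rewrite scale1r. Qed.
Let pext_scaleDr : right_distributive pext_scale +%R.
Proof. by move=> a x y; apply: pextP => [|w] /=; rewrite scalerDr. Qed.
Let pext_scaleDl x : {morph pext_scale^~ x : a b / a + b}.
Proof. by move=> a b; apply: pextP => [|w] /=; rewrite scalerDl. Qed.

HB.instance Definition _ := GRing.Zmodule_isLmodule.Build k pext
  pext_scaleA pext_scale1 pext_scaleDr pext_scaleDl.

Let pext_scaleAl (a : k) (x y : pext) : a *: (x * y) = (a *: x) * y.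
Proof.
apply: pextP => [|w] /=; first by rewrite scalerAl.
by rewrite scalerDr scalerAl -scalerAr.
Qed.

HB.instance Definition _ :=
  GRing.Lmodule_isLalgebra.Build k pext pext_scaleAl.
HB.instance Definition _ := GRing.Lalgebra_isComAlgebra.Build k pext.

Lemma conv_linZl (a : k) n m (l : seq I -> Q) w :
  conv (fun s => a *: n s + m s) l w = a *: conv n l w + conv m l w.
Proof.
rewrite -[a *: conv n l w]mul1r -scalerAr scalerAl -conv_linl.
by apply: eq_conv => // s; rewrite -scalerAl mul1r.
Qed.

Lemma conv_linZr (a : k) n m (l : seq I -> Q) w :
  conv l (fun s => a *: n s + m s) w = a *: conv l n w + conv l m w.
Proof.
rewrite -[a *: conv l n w]mul1r -scalerAr scalerAl -conv_linr.
by apply: eq_conv => // s; rewrite -scalerAl mul1r.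
Qed.

Let pext_bracket_linl (a : k) (x y z : pext) :
  pext_bracket (a *: x + y) z = a *: pext_bracket x z + pext_bracket y z.
Proof.
apply: pextP => [|w] /=; first exact: bracket_linearl.
rewrite conv_linZl conv_linZr bracket_linearl bracket_linearr !scalerDr !scalerN.
by ring.
Qed.

Let pext_bracketxx (x : pext) : pext_bracket x x = 0.
Proof. by apply: pextP => [|w] /=; rewrite ?bracketxx // !subrr addr0. Qed.

Let pext_bracketC (x y : pext) : pext_bracket x y = - pext_bracket y x.
Proof. by apply: pextP => [|w] /=; rewrite 1?bracketC //; ring. Qed.

Let pext_bracket_linr (a : k) (x y z : pext) :
  pext_bracket x (a *: y + z) = a *: pext_bracket x y + pext_bracket x z.
Proof.
by rewrite pext_bracketC pext_bracket_linl opprD -scalerN -!pext_bracketC.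
Qed.

Lemma bracket_conv p n m w : bracket p (conv n m w) =
  conv (fun s => bracket p (n s)) m w + conv n (fun s => bracket p (m s)) w.
Proof. by apply: conv_der => a b; rewrite ?bracketDr ?bracket_leibniz. Qed.

Lemma convB n m (l : seq I -> Q) w :
  conv (fun s => n s - m s) l w = conv n l w - conv m l w.
Proof.
rewrite addrC -[X in X + _]mulN1r -conv_linl; apply: eq_conv => // s.
by rewrite mulN1r addrC.
Qed.

Lemma convBr n m (l : seq I -> Q) w :
  conv l (fun s => n s - m s) w = conv l n w - conv l m w.
Proof.
rewrite addrC -[X in X + _]mulN1r -conv_linr; apply: eq_conv => // s.
by rewrite mulN1r addrC.
Qed.

Lemma convD n m (l : seq I -> Q) w :
  conv (fun s => n s + m s) l w = conv n l w + conv m l w.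
Proof.
rewrite -[X in X + _]mul1r -conv_linl; apply: eq_conv => // s; by rewrite mul1r.
Qed.

Lemma convDr n m (l : seq I -> Q) w :
  conv l (fun s => n s + m s) w = conv l n w + conv l m w.
Proof.
rewrite -[X in X + _]mul1r -conv_linr; apply: eq_conv => // s; by rewrite mul1r.
Qed.

Lemma conv0r n w : conv n (fun=> 0) w = 0.
Proof. by elim: w n => [|i s IHs] n /=; rewrite mulr0 ?IHs ?addr0. Qed.

Lemma convZ p n (l : seq I -> Q) w : conv (fun s => p * n s) l w = p * conv n l w.
Proof.
rewrite -[RHS]addr0 -(conv0l (n := fun=> 0) l w) // -conv_linl.
by apply: eq_conv => // s; rewrite addr0.
Qed.

Lemma convZr p n (l : seq I -> Q) w : conv l (fun s => p * n s) w = p * conv l n w.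
Proof.
rewrite -[RHS]addr0 -(conv0r l w) -conv_linr.
by apply: eq_conv => // s; rewrite addr0.
Qed.

Lemma convN n (l : seq I -> Q) w : conv (fun s => - n s) l w = - conv n l w.
Proof.
rewrite -[RHS]sub0r -(conv0l (n := fun=> 0) l w) // -convB.
by apply: eq_conv => // s; rewrite sub0r.
Qed.

Lemma convNr n (l : seq I -> Q) w : conv l (fun s => - n s) w = - conv l n w.
Proof.
apply: (addrI (conv l n w)); rewrite subrr -convDr.
rewrite -[RHS](conv0r l w).
by apply: eq_conv => // s; rewrite subrr.
Qed.

Let pext_jacobi (x y z : pext) :
  pext_bracket x (pext_bracket y z) + pext_bracket y (pext_bracket z x)
    + pext_bracket z (pext_bracket x y) = 0.
Proof.
case: x y z => [p n] [q m] [r l]; apply: pextP => [|w] /=.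
  exact: bracket_jacobi.
rewrite !(bracketDr, bracketNr) !bracket_conv.
rewrite !(convD, convDr, convB, convBr, convN, convNr).
rewrite !convA !(jacobi_der p q) !(jacobi_der q r) !(jacobi_der r p).
by ring.
Qed.

Let pext_leibniz (x y z : pext) :
  pext_bracket x (y * z) = pext_bracket x y * z + y * pext_bracket x z.
Proof.
case: x y z => [p n] [q m] [r l]; apply: pextP => [|w] /=.
  exact: bracket_leibniz.
rewrite !(bracketDr, bracket_leibniz, bracketMl).
rewrite convDr convD !convZ !convZr; ring.
Qed.

HB.instance Definition _ := isPoisson.Build k pext
  pext_bracket_linl pext_bracket_linr pext_bracketxx pext_jacobi pext_leibniz.

End Extension.

(** * Generation by the variables, and Poisson morphisms *)

Section Generation.
Local Open Scope quotient_scope.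

Lemma freePoisson_generated (k : fieldType) (n : nat) (p : freePoisson k n) :
  poisson_generated (fun y => exists j, y = pvar k j) p.
Proof.
pose cl s : freePoisson k n := \pi_{eq_quot (@teqb k n)} s.
have clP s t : teq s t -> cl s = cl t.
  move=> st; have E : s = t %[mod {eq_quot (@teqb k n)}] by apply/eqmodP/asboolP.
  exact: E.
have rpP s : teq (repr (cl s : {eq_quot (@teqb k n)})) s.
  have E : repr (\pi_{eq_quot (@teqb k n)} s) = s %[mod {eq_quot (@teqb k n)}].
    by rewrite reprK.
  by apply/asboolP; move/eqmodP: E.
have gen1 := @POne k (freePoisson k n) (fun y => exists j, y = pvar k j).
have gen0 : poisson_generated (fun y => exists j, y = pvar k j) (0 : freePoisson k n).
  by have := PLin (-1) gen1 gen1; rewrite scaleN1r addNr.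
have -> : p = cl (repr (p : {eq_quot (@teqb k n)})) by rewrite /cl reprK.
elim: (repr _) => [i|||s gs|s gs t gt|a s gs|s gs t gt|s gs t gt] //.
- by apply: PGen; exists i.
- have -> : cl (TOpp s) = - cl s by apply/esym/clP/teq_opp/rpP.
  by have := PLin (-1) gs gen0; rewrite scaleN1r addr0.
- have -> : cl (TAdd s t) = cl s + cl t by apply/esym/clP/teq_add; apply: rpP.
  by have := PLin 1 gs gt; rewrite scale1r.
- have -> : cl (TScale a s) = a *: cl s by apply/esym/clP/teq_scale/rpP.
  by have := PLin a gs gen0; rewrite addr0.
- have -> : cl (TMul s t) = cl s * cl t by apply/esym/clP/teq_mul; apply: rpP.
  exact: PMul.
- have -> : cl (TBracket s t) = bracket (cl s) (cl t).
    by apply/esym/clP/teq_bracket; apply: rpP.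
  exact: PBracket.
Qed.

End Generation.

Section PoissonMorphism.
Variables (k : fieldType) (P Q : poissonAlgType k) (f : P -> Q).
Hypothesis fP : poisson_morphism f.

Lemma pmorphD x y : f (x + y) = f x + f y.
Proof. by case: fP => fl _ _; have := fl 1 x y; rewrite !scale1r. Qed.

Lemma pmorph0 : f 0 = 0.
Proof. by apply: (addrI (f 0)); rewrite -pmorphD !addr0. Qed.

Lemma pmorphZ a x : f (a *: x) = a *: f x.
Proof. by case: fP => fl _ _; rewrite -[a *: x]addr0 fl pmorph0 addr0. Qed.

Lemma pmorphN x : f (- x) = - f x.
Proof. by rewrite -scaleN1r pmorphZ scaleN1r. Qed.

Lemma pmorphM x y : f (x * y) = f x * f y.
Proof. by case: fP => _ [_ fM] _. Qed.

Lemma pmorph1 : f 1 = 1.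
Proof. by case: fP => _ []. Qed.

Lemma pmorph_bracket x y : f (bracket x y) = bracket (f x) (f y).
Proof. by case: fP. Qed.

End PoissonMorphism.

(** * The universal derivation, the degree filtration and the Euler derivation *)

Section FoxDerivation.
Variables (k : fieldType) (n : nat).
Notation P := (freePoisson k n).
Implicit Types (p q x y z : P) (e : lie 'I_n) (s t w : seq 'I_n) (i j : 'I_n).

(** A derivation is the second component of a morphism into a split extension, which the universal
    property provides. *)
Definition fox_lift : P -> pext P 'I_n :=
  fp_lift (fun i => Pext (pvar k i) (letter P i)).

(* The universal derivation of [P], with the differential of [x_i] equal to
   the word [x_i]. *)
Definition fox p w : P := pword (fox_lift p) w.

Lemma fox_lift_morphism : poisson_morphism fox_lift.
Proof. exact: fp_lift_morphism. Qed.

Lemma fox_liftE p : pbase (fox_lift p) = p.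
Proof.
have idP : poisson_morphism (@idfun P) by [].
have baseP : poisson_morphism (fun p => pbase (fox_lift p)).
  case: fox_lift_morphism => fl [f1 fM] fB; split=> [a x y||x y].
  - by rewrite fl.
  - by split=> [|x y]; rewrite ?f1 ?fM.
  - by rewrite fB.
rewrite (fp_lift_unique baseP (v := @pvar k n)) => [|i].
  by rewrite -(fp_lift_unique idP (v := @pvar k n)).
by rewrite /fox_lift fp_lift_pvar.
Qed.

Lemma fox_pvar i : fox (pvar k i) = letter P i.
Proof. by rewrite /fox /fox_lift fp_lift_pvar. Qed.

Lemma fox1 w : fox 1 w = 0.
Proof. by rewrite /fox (pmorph1 fox_lift_morphism). Qed.

Lemma foxZ a x w : fox (a *: x) w = a *: fox x w.
Proof. by rewrite /fox (pmorphZ fox_lift_morphism). Qed.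

Lemma foxD x y w : fox (x + y) w = fox x w + fox y w.
Proof. by rewrite /fox (pmorphD fox_lift_morphism). Qed.

Lemma foxM x y w : fox (x * y) w = x * fox y w + y * fox x w.
Proof. by rewrite /fox (pmorphM fox_lift_morphism) /= !fox_liftE. Qed.

Lemma fox_bracket x y w : fox (bracket x y) w =
  bracket x (fox y w) - bracket y (fox x w)
    + (conv (fox x) (fox y) w - conv (fox y) (fox x) w).
Proof. by rewrite /fox (pmorph_bracket fox_lift_morphism) /= !fox_liftE. Qed.

Lemma fox_alg a w : fox a%:A w = 0.
Proof. by rewrite foxZ fox1 scaler0. Qed.

Lemma fox0 w : fox 0 w = 0.
Proof. by have := fox_alg 0 w; rewrite scale0r. Qed.

Fixpoint lie_val e : P :=
  match e with
  | LieVar i => pvar k i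
  | LieBr e f => bracket (lie_val e) (lie_val f)
  end.

Lemma conv_alg (u v : seq 'I_n -> k) w :
  conv (fun s => (u s)%:A : P) (fun s => (v s)%:A) w = (conv u v w)%:A.
Proof.
elim: w u => [|i w IHw] u /=; first by rewrite -scalerAl mul1r scalerA.
by rewrite IHw scalerDl -scalerAl mul1r scalerA.
Qed.

(** By induction the coefficients are scalars, so the brackets with them vanish and only the
    commutator of words is left. *)
Lemma fox_lie e w : fox (lie_val e) w = (lie_word k e w)%:A.
Proof.
elim: e w => [i|e IHe f IHf] w /=.
  by rewrite fox_pvar /letter; case: eqP => _; rewrite ?scale1r ?scale0r.
rewrite fox_bracket IHe IHf !bracket_alg_r subr0 add0r scalerBl -!conv_alg.
by congr (_ - _); apply: eq_conv.
Qed.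

(** The span of the products of Lie monomials of total degree at most [N]: a filtration, whose
    definition presupposes no basis of [P]. *)
Inductive lie_filt : nat -> P -> Prop :=
| FiltC N a : lie_filt N a%:A
| FiltD N x y of lie_filt N x & lie_filt N y : lie_filt N (x + y)
| FiltM N M e x of lie_filt M x & (lie_deg e + M <= N)%N :
    lie_filt N (lie_val e * x).

Lemma lie_filt0 N : lie_filt N 0.
Proof. by have := FiltC N 0; rewrite scale0r. Qed.

Lemma lie_filtZ N a x : lie_filt N x -> lie_filt N (a *: x).
Proof.
elim=> {N x} [N b|N x y _ IHx _ IHy|N M e x _ IHx le].
- by rewrite scalerA; apply: FiltC.
- by rewrite scalerDr; apply: FiltD.
- by rewrite scalerAr; apply: FiltM le.
Qed.

Lemma lie_filt_le N M x : lie_filt N x -> (N <= M)%N -> lie_filt M x.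
Proof.
elim=> {N x} [N b|N x y _ IHx _ IHy|N K e x fx _ le] NM.
- exact: FiltC.
- by apply: FiltD; [apply: IHx | apply: IHy].
- exact: (FiltM fx (leq_trans le NM)).
Qed.

Lemma lie_filtM N M x y : lie_filt N x -> lie_filt M y -> lie_filt (N + M)%N (x * y).
Proof.
move=> + fy; elim=> {N x} [N b|N x z _ IHx _ IHz|N K e x _ IHx le].
- by rewrite -scalerAl mul1r; apply: lie_filtZ; apply: lie_filt_le fy (leq_addl _ _).
- by rewrite mulrDl; apply: FiltD.
- by rewrite -mulrA; apply: (FiltM IHx); rewrite addnA leq_add2r.
Qed.

Lemma lie_filt_lie e : lie_filt (lie_deg e) (lie_val e).
Proof.
rewrite -[lie_val e]mulr1; apply: (@FiltM _ 0); last by rewrite addn0.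
by rewrite -(scale1r 1); apply: FiltC.
Qed.

Lemma lie_filt_ex p : exists N, lie_filt N p.
Proof.
have fD x y : (exists N, lie_filt N x) -> (exists N, lie_filt N y) ->
    exists N, lie_filt N (x + y).
  move=> [N fx] [M fy]; exists (N + M)%N; apply: FiltD.
    exact: lie_filt_le fx (leq_addr _ _).
  exact: lie_filt_le fy (leq_addl _ _).
have fM x y : (exists N, lie_filt N x) -> (exists N, lie_filt N y) ->
    exists N, lie_filt N (x * y).
  by move=> [N fx] [M fy]; exists (N + M)%N; apply: lie_filtM.
have fe e : exists N, lie_filt N (lie_val e) by exists (lie_deg e); apply: lie_filt_lie.
have feB e y N : lie_filt N y -> exists N, lie_filt N (bracket (lie_val e) y).
  elim=> {N y} [N b|N x y _ IHx _ IHy|N M f x fx IHx _].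
  - by rewrite bracket_alg_r; exists 0%N; apply: lie_filt0.
  - by rewrite bracketDr; apply: fD.
  - rewrite bracket_leibniz; apply: fD; apply: fM => //; last by exists M.
    exact: (fe (LieBr e f)).
elim: (freePoisson_generated p) => {p} [x [j ->]||a x y _ fx _ fy
  |x y _ fx _ fy|x y _ [N fx] _ [M fy]].
- exact: (fe (LieVar j)).
- by exists 0%N; rewrite -(scale1r 1); apply: FiltC.
- by apply: fD => //; case: fx => N fx; exists N; apply: lie_filtZ.
- exact: fM.
- elim: fx => {N x} [N b|N x z _ IHx _ IHz|N K e x fx IHx _].
  + by rewrite bracket_alg_l; exists 0%N; apply: lie_filt0.
  + by rewrite bracketDl; apply: fD.
  + rewrite bracketMl; apply: fD; apply: fM => //; last by exists K.
    exact: feB fy.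
Qed.

Lemma lie_filt0P x : lie_filt 0 x -> exists a, x = a%:A.
Proof.
suff H N : lie_filt N x -> N = 0%N -> exists a, x = a%:A by move=> /H; apply.
elim=> {N x} [N a|N x y _ IHx _ IHy|N M e x _ _ le] N0.
- by exists a.
- have [a ->] := IHx N0; have [b ->] := IHy N0.
  by exists (a + b); rewrite scalerDl.
- by move: le; rewrite N0 leqn0 addn_eq0 eqn0Ngt lie_deg_gt0.
Qed.

Lemma fox_liespan p : liespan (fox p).
Proof.
have [N] := lie_filt_ex p; elim=> {N p} [N a|N x y _ IHx _ IHy|N M e x _ IHx _].
- suff -> : fox a%:A = fun=> 0 by apply: lieSpan0.
  by apply/funext => w; rewrite fox_alg.
- suff -> : fox (x + y) = fun w => 1 * fox x w + fox y w by apply: liespan_lin.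
  by apply/funext => w; rewrite foxD mul1r.
- suff -> : fox (lie_val e * x) = fun w => x * (lie_word k e w)%:A +
      (lie_val e * fox x w + 0).
    by apply: lieSpanD; apply: liespan_lin => //; apply: lieSpan0.
  by apply/funext => w; rewrite foxM fox_lie addr0 addrC.
Qed.

Lemma fox_filt N x w : lie_filt N x -> lie_filt N.-1 (fox x w).
Proof.
elim=> {N x} [N a|N x y _ IHx _ IHy|N M e x fx IHx le].
- by rewrite fox_alg; apply: lie_filt0.
- by rewrite foxD; apply: FiltD.
- have e0 := lie_deg_gt0 e.
  rewrite foxM fox_lie; apply: FiltD.
    case: M fx IHx le => [|M] fx IHx le.
      by have [a ->] := lie_filt0P fx; rewrite fox_alg mulr0; apply: lie_filt0.
    by apply: (FiltM IHx); rewrite /=; lia.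
  rewrite -scalerAr mulr1; apply: lie_filtZ; apply: (lie_filt_le fx); lia.
Qed.

(** For a fixed word, the coefficient of the differential is a derivation of the product that sends
    Lie monomials to scalars, like a vector field with constant coefficients. *)
Lemma foxC x w w' : fox (fox x w) w' = fox (fox x w') w.
Proof.
have [N] := lie_filt_ex x; elim=> {N x} [N a|N x y _ IHx _ IHy|N M e x fx IHx le].
- by rewrite !fox_alg !fox0.
- by rewrite !(foxD, IHx, IHy).
- by rewrite !(foxM, foxD, fox_lie) !fox_alg IHx; ring.
Qed.

(** Right-normed brackets: the Dynkin operator on words. *)
Fixpoint theta w : P :=
  match w with
  | [::] => 0
  | [:: i] => pvar k i
  | i :: w' => bracket (pvar k i) (theta w')
  end.

Definition adw s z : P := foldr (fun i => bracket (pvar k i)) z s.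

Lemma theta_cat s t : t != [::] -> theta (s ++ t) = adw s (theta t).
Proof.
move=> t0; elim: s => //= i s <-.
by case E: (s ++ t) => [|j r] //; move: E t0; case: s => //= ->.
Qed.

Lemma adw_wsum d (b : seq 'I_n -> k) (F : seq 'I_n -> P) s :
  adw s (wsum d (fun t => (b t)%:A * F t)) = wsum d (fun t => (b t)%:A * adw s (F t)).
Proof.
elim: s => //= i s ->; elim: d b F => [|d IHd] b F /=.
  by rewrite -!scalerAl !mul1r bracketZr.
rewrite -[RHS](eq_bigr _ (fun j _ => IHd (fun t => b (j :: t)) (fun t => F (j :: t)))).
by elim/big_rec2: _ => [|j x y _ <-]; rewrite ?bracket0r ?bracketDr.
Qed.

Lemma wsum_lie_br e f (F : seq 'I_n -> P) :
  wsum (lie_deg (LieBr e f)) (fun s => (lie_word k (LieBr e f) s)%:A * F s) =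
  wsum (lie_deg e) (fun s => (lie_word k e s)%:A *
     wsum (lie_deg f) (fun t => (lie_word k f t)%:A * F (s ++ t))) -
  wsum (lie_deg f) (fun s => (lie_word k f s)%:A *
     wsum (lie_deg e) (fun t => (lie_word k e t)%:A * F (s ++ t))).
Proof.
have := @wder_br _ k P e f F [::]; rewrite /wder => E.
rewrite [LHS]E; congr (_ - _); apply: eq_wsum => s _; congr (_ * _);
  by apply: eq_wsum => t _.
Qed.

(** By the Jacobi identity the adjoint action represents commutators of words as brackets. *)
Lemma wsum_lie_adw e z :
  wsum (lie_deg e) (fun s => (lie_word k e s)%:A * adw s z) = bracket (lie_val e) z.
Proof.
elim: e z => [i|e IHe f IHf] z.
  rewrite /= (bigD1 i) //= eqxx scale1r mul1r big1 ?addr0 // => j ji.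
  by rewrite eqseq_cons (negbTE ji) scale0r mul0r.
rewrite wsum_lie_br /= -[bracket (bracket _ _) z]
  (addrK (bracket (lie_val f) (bracket (lie_val e) z))).
rewrite -jacobi_der -IHf -[bracket _ (bracket (lie_val e) z)]IHf -!IHe.
congr (_ - _); apply: eq_wsum => s _.
  rewrite adw_wsum; congr (_ * _); apply: eq_wsum => t _; congr (_ * _).
  by rewrite /adw foldr_cat.
rewrite adw_wsum; congr (_ * _); apply: eq_wsum => t _; congr (_ * _).
by rewrite /adw foldr_cat.
Qed.

(** Dynkin-Specht-Wever: on a product of words the operator is the adjoint action of the first
    factor on its value at the second. The two halves of a commutator thus contribute the degrees of
    [f] and of [e]. *)
Lemma dynkin e :
  wsum (lie_deg e) (fun s => (lie_word k e s)%:A * theta s) = (lie_deg e)%:R * lie_val e.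
Proof.
elim: e => [i|e IHe f IHf].
  rewrite /= mul1r (bigD1 i) //= eqxx scale1r mul1r big1 ?addr0 // => j ji.
  by rewrite eqseq_cons (negbTE ji) scale0r mul0r.
have br e1 f1 : wsum (lie_deg e1) (fun s => (lie_word k e1 s)%:A *
     wsum (lie_deg f1) (fun t => (lie_word k f1 t)%:A * theta (s ++ t))) =
   bracket (lie_val e1) (wsum (lie_deg f1) (fun s => (lie_word k f1 s)%:A * theta s)).
  rewrite -wsum_lie_adw; apply: eq_wsum => s _; rewrite adw_wsum; congr (_ * _).
  apply: eq_wsum => t tf; rewrite theta_cat //.
  by rewrite -size_eq0 tf -lt0n lie_deg_gt0.
rewrite wsum_lie_br !br IHe IHf !mulr_natl.
rewrite -!scaler_nat !bracketZr (bracketC (lie_val f)) scalerN opprK -scalerDl.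
by rewrite -natrD addnC.
Qed.

(* The Euler derivation of [P], truncated above degree [K]. *)
Definition euler K p : P :=
  \sum_(l < K.+1) wsum l (fun w => fox p w * theta w).

Lemma eulerD K x y : euler K (x + y) = euler K x + euler K y.
Proof.
rewrite /euler -big_split; apply: eq_bigr => l _ /=.
by rewrite -wsumD; apply: eq_wsum => w _; rewrite foxD mulrDl.
Qed.

Lemma eulerM K x y : euler K (x * y) = x * euler K y + y * euler K x.
Proof.
rewrite /euler !mulr_sumr -big_split; apply: eq_bigr => l _ /=.
by rewrite -!wsumZ -wsumD; apply: eq_wsum => w _; rewrite foxM; ring.
Qed.

Lemma euler_alg K a : euler K a%:A = 0.
Proof.
apply: big1 => l _; apply: wsum0 => w _; by rewrite fox_alg mul0r.
Qed.

Lemma euler_lie K e :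
  (lie_deg e <= K)%N -> euler K (lie_val e) = (lie_deg e)%:R * lie_val e.
Proof.
move=> eK; rewrite /euler (bigD1 (Ordinal (eK : (lie_deg e < K.+1)%N))) //=.
rewrite big1 ?addr0 => [|l le].
  by rewrite -dynkin; apply: eq_wsum => w _; rewrite fox_lie.
apply: wsum0 => w wl; rewrite fox_lie (@lie_word_hom _ k e) ?scale0r ?mul0r //.
by rewrite wl; apply: contra le => /eqP E; apply/eqP/val_inj.
Qed.

Lemma lie_filt_nat N m x : lie_filt N x -> lie_filt N (m%:R * x).
Proof. by move=> fx; rewrite mulr_natl -scaler_nat; apply: lie_filtZ. Qed.

(** By [dynkin], a product of Lie monomials of total degree exactly [N] is an eigenvector of
    eigenvalue [N]. *)
Lemma euler_filt K N x : lie_filt N x -> (N <= K)%N ->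
  lie_filt N.-1 (N%:R * x - euler K x).
Proof.
elim=> {N x} [N a|N x y _ IHx _ IHy|N M e x fx IHx le] NK.
- by rewrite euler_alg subr0; apply: lie_filt_nat; apply: FiltC.
- have -> : N%:R * (x + y) - euler K (x + y) =
     (N%:R * x - euler K x) + (N%:R * y - euler K y) by rewrite eulerD; ring.
  by apply: FiltD; [apply: IHx|apply: IHy].
- have e0 := lie_deg_gt0 e.
  rewrite eulerM euler_lie; last by lia.
  rewrite -(subnKC le) !natrD.
  (* The slack in the bound [N]: if it is positive, the product already lies one step lower. *)
  set d := (N - _)%N.
  have -> : ((lie_deg e)%:R + M%:R + d%:R) * (lie_val e * x) -
    (lie_val e * euler K x + x * ((lie_deg e)%:R * lie_val e)) =
    d%:R * (lie_val e * x) + lie_val e * (M%:R * x - euler K x) by ring.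
  apply: FiltD.
    have [->|dn0] := eqVneq d 0%N; first by rewrite mul0r; apply: lie_filt0.
    by apply: lie_filt_nat; apply: (FiltM fx); lia.
  case: M fx IHx le @d => [|M] fx IHx le d.
    have [a ->] := lie_filt0P fx; rewrite euler_alg mul0r subr0 mulr0.
    exact: lie_filt0.
  by apply: (FiltM (IHx _)); rewrite /=; lia.
Qed.

End FoxDerivation.

(** * Integrality of the free Poisson algebra, and its polynomial elements *)

Section CharacteristicZero.
Variables (k : fieldType) (n : nat).
Hypothesis char0 : [pchar k] =i pred0.
Notation P := (freePoisson k n).
Implicit Types (p q x y z f g : P) (e : lie 'I_n) (s t w : seq 'I_n) (i j : 'I_n).

Lemma lie_filt_scale N m x : lie_filt N (m.+1%:R * x) -> lie_filt N x.
Proof.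
move=> /(lie_filtZ (m.+1%:R^-1)); rewrite mulr_natl -scaler_nat scalerA.
by rewrite mulVf ?scale1r // natr_neq0.
Qed.

(** The Euler derivation kills [x], so a nonzero integer multiple of [x] moves down the
    filtration. *)
Lemma fox_eq0 x : (forall w, fox x w = 0) -> exists a, x = a%:A.
Proof.
have [N] := lie_filt_ex x; elim: N => [|N IHN] fx x0; first exact: lie_filt0P.
apply: IHN => //; apply: (@lie_filt_scale _ N).
have := euler_filt fx (leqnn _); rewrite [X in _ - X]big1 ?subr0 // => l _.
by apply: wsum0 => w _; rewrite x0 mul0r.
Qed.

Lemma fox_iter_filt N a x w : lie_filt N x ->
  lie_filt (N - a)%N (iter a (fun p => fox p w) x).
Proof.
move=> fx; elim: a => [|a IHa] /=; first by rewrite subn0.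
by rewrite subnS; apply: fox_filt.
Qed.

Lemma fox_iter0 a w : iter a (fun p => fox p w) (0 : P) = 0.
Proof. by elim: a => //= a ->; rewrite fox0. Qed.

Lemma fox_iter_max x w : x <> 0 -> exists a,
  iter a (fun p => fox p w) x <> 0 /\ iter a.+1 (fun p => fox p w) x = 0.
Proof.
move=> x0; have [N fx] := lie_filt_ex x.
have ex : exists a, iter a.+1 (fun p => fox p w) x == 0.
  exists N; have := @fox_iter_filt N N x w fx; rewrite subnn => /lie_filt0P[b] /= ->.
  by rewrite fox_alg.
case: (ex_minnP ex) => -[|a] /eqP a0 amin; first by exists 0%N.
by exists a.+1; split=> // /eqP /amin; rewrite ltnn.
Qed.

(** Only one term of the iterated Leibniz formula survives; of its binomial coefficient just the
    positivity is recorded. *)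
Lemma fox_leibniz a b x y w :
  iter a.+1 (fun p => fox p w) x = 0 -> iter b.+1 (fun p => fox p w) y = 0 ->
  exists m, iter (a + b) (fun p => fox p w) (x * y) =
    m.+1%:R * (iter a (fun p => fox p w) x * iter b (fun p => fox p w) y).
Proof.
have iterD c u v : iter c (fun p => fox p w) (u + v) =
    iter c (fun p => fox p w) u + iter c (fun p => fox p w) v.
  by elim: c => //= c ->; rewrite foxD.
have S c z : iter c.+1 (fun p => fox p w) z = iter c (fun p => fox p w) (fox z w).
  exact: iterSr.
have [c] := ubnP (a + b); elim: c a b x y => // c IHc [|a] [|b] x y le x0 y0.
- by exists 0%N; rewrite mul1r.
- have y1 := y0; rewrite S in y1.
  have [m E] := IHc 0%N b x (fox y w) (ltac:(by lia)) x0 y1.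
  exists m; rewrite add0n S foxM.
  by rewrite (x0 : fox x w = 0) mulr0 addr0 E -S.
- have x1 := x0; rewrite S in x1.
  have [m E] := IHc a 0%N (fox x w) y (ltac:(by lia)) x1 y0.
  exists m; rewrite addSn S foxM.
  by rewrite (y0 : fox y w = 0) mulr0 add0r mulrC E -S.
- have x1 := x0; rewrite S in x1; have y1 := y0; rewrite S in y1.
  have [m1 E1] := IHc a b.+1 (fox x w) y (ltac:(by lia)) x1 y0.
  have [m2 E2] := IHc a.+1 b x (fox y w) (ltac:(by lia)) x0 y1.
  exists (m1 + m2).+1; rewrite addSn S foxM iterD [y * _]mulrC E1.
  rewrite addnS -addSn E2 -!S -mulrDl -natrD.
  by congr (_%:R * _); lia.
Qed.

(** Coefficient derivations are locally nilpotent. If one of them does not kill [f], the last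
    nonzero iterates of [f] and [g] have product zero and a smaller total degree. *)
Lemma freePoisson_domain f g : f * g = 0 -> f = 0 \/ g = 0.
Proof.
have [N ff] := lie_filt_ex f; have [M fg] := lie_filt_ex g.
have [c] := ubnP (N + M).
elim: c N M f g ff fg => // c IHc N M f g ff fg le fg0.
have [f0|f0] := pselect (forall w, fox f w = 0).
  have [a fa] := fox_eq0 f0; have [a0|a0] := eqVneq a 0.
    by left; rewrite fa a0 scale0r.
  right; rewrite -[g]scale1r -(mulVf a0) -scalerA -[a *: g]mul1r -scalerAr scalerAl.
  by rewrite -fa fg0 scaler0.
have [g0|g0] := pselect (g = 0); first by right.
left; apply: contrapT => fn0.
move: f0 => /existsNP[w fw].
have [[|a] [fa fa1]] := fox_iter_max w fn0; first by case: fw.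
have [b [gb gb1]] := fox_iter_max w g0.
have [m] := fox_leibniz fa1 gb1.
rewrite fg0 fox_iter0 => /esym/(natr_reg char0).
have N0 : (0 < N)%N.
  rewrite lt0n; apply/eqP => N0; move: ff fw.
  by rewrite N0 => /lie_filt0P[d ->] []; rewrite fox_alg.
case/(IHc _ _ _ _ (@fox_iter_filt _ a.+1 _ w ff) (@fox_iter_filt _ b _ w fg)) => //.
by lia.
Qed.

Inductive polysub : P -> Prop :=
| PolyC a : polysub a%:A
| PolyX i : polysub (pvar k i)
| PolyD x y of polysub x & polysub y : polysub (x + y)
| PolyM x y of polysub x & polysub y : polysub (x * y).

(** The Euler derivation then involves only the coefficients at letters, which satisfy the same
    hypothesis by [foxC] and have smaller degree. *)
Lemma polysub_fox x : (forall w, (1 < size w)%N -> fox x w = 0) -> polysub x.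
Proof.
have [N] := lie_filt_ex x; elim: N x => [|N IHN] x fx xw.
  by have [a ->] := lie_filt0P fx; apply: PolyC.
have eE : euler N.+1 x = \sum_i fox x [:: i] * pvar k i.
  rewrite /euler !big_ord_recl big1 => [|l _] /=; first by rewrite mulr0 add0r addr0.
  by apply: big1 => i _; apply: big1 => j _; apply: wsum0 => w _; rewrite xw ?mul0r.
have eP : polysub (euler N.+1 x).
  rewrite eE; elim/big_ind: _ => [|y z|i _].
  - by have := PolyC 0; rewrite scale0r.
  - exact: PolyD.
  - apply: PolyM (PolyX i); apply: IHN; first exact: fox_filt fx.
    by move=> w sw; rewrite foxC (xw w sw) fox0.
have dP : polysub (N.+1%:R * x - euler N.+1 x).
  apply: IHN; first exact: (euler_filt fx).
  have fsum (I : finType) (F : I -> P) w : fox (\sum_i F i) w = \sum_i fox (F i) w.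
    by elim/big_rec2: _ => [|i y z _ <-]; rewrite ?fox0 ?foxD.
  move=> w sw; rewrite foxD -scaleN1r foxZ eE fsum big1 => [|i _].
    by rewrite scaler0 addr0 mulr_natl -scaler_nat foxZ xw // scaler0.
  rewrite foxM foxC (xw w sw) fox0 mulr0 addr0 fox_pvar /letter.
  by case: eqP sw => [->|_]; rewrite ?mulr0.
have := PolyM (PolyC N.+1%:R^-1) (PolyD dP eP).
rewrite subrK -scalerAl mul1r mulr_natl -scaler_nat scalerA mulVf ?scale1r //.
exact: natr_neq0.
Qed.

End CharacteristicZero.

(** * Differentials under an automorphism of k{x, y} *)

Section PolynomialImages.
Variable k : fieldType.
Hypothesis char0 : [pchar k] =i pred0.
Notation P := (freePoisson k 2).
Notation bk := (fun i => bracket (pvar k i) : P -> P).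
Implicit Types (p q : P) (u v w : seq 'I_2 -> P).

Lemma submodule0 (w1 w2 : seq 'I_2 -> P) : submodule bk w1 w2 (fun=> 0).
Proof.
suff -> : (fun=> 0) = fun s => -1 * w1 s + w1 s by apply: SubLin; apply: SubL.
by apply/funext => s; rewrite mulN1r addNr.
Qed.

Lemma submoduleD (w1 w2 : seq 'I_2 -> P) u v :
  submodule bk w1 w2 u -> submodule bk w1 w2 v ->
  submodule bk w1 w2 (fun s => u s + v s).
Proof.
move=> hu hv; suff -> : (fun s => u s + v s) = fun s => 1 * u s + v s by apply: SubLin.
by apply/funext => s; rewrite mul1r.
Qed.

Lemma submoduleZ (w1 w2 : seq 'I_2 -> P) p u :
  submodule bk w1 w2 u -> submodule bk w1 w2 (fun s => p * u s).
Proof.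
move=> hu; suff -> : (fun s => p * u s) = fun s => p * u s + 0.
  by apply: SubLin => //; apply: submodule0.
by apply/funext => s; rewrite addr0.
Qed.

(** The operator attached to [q] in the enveloping algebra. For a product it is a combination, and
    for a bracket a commutator, of the operators of the factors, so stability under the variables
    suffices. *)
Lemma submodule_hact (w1 w2 : seq 'I_2 -> P) q u : submodule bk w1 w2 u ->
  submodule bk w1 w2 (fun s => bracket q (u s) + conv (fox q) u s).
Proof.
elim: (freePoisson_generated q) u => {q} [_ [i ->]||a x y _ hx _ hy
  |x y _ hx _ hy|x y _ hx _ hy] u hu.
- suff -> : (fun s => bracket (pvar k i) (u s) + conv (fox (pvar k i)) u s) = hact bk i u.
    exact: SubAct.
  apply/funext => s; rewrite /hact; congr (_ + _).
  rewrite (eq_conv (n' := letter P i) (m' := u)) //; last by move=> t; rewrite fox_pvar.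
  case: s => [|j s] /=; first by rewrite mul0r.
  rewrite mul0r add0r; case: (eqVneq i j) => [->|ij].
    transitivity (conv (fun s => 1 * (s == [::])%:R) u s).
      by apply: eq_conv => // t; rewrite /letter eqseq_cons eqxx mul1r.
    case: s => [|l s] /=; first by rewrite mul1r.
    by rewrite !mul1r (conv0l u) ?addr0 // => t; rewrite mul1r.
  rewrite mul0r; apply: conv0l => t.
  by rewrite /letter eqseq_cons eq_sym (negbTE ij).
- suff -> : (fun s => bracket 1 (u s) + conv (fox (1 : P)) u s) = fun=> 0 by apply: submodule0.
  apply/funext => s; rewrite bracketC bracket1r oppr0 add0r.
  by apply: conv0l => t; rewrite fox1.
- suff -> : (fun s => bracket (a *: x + y) (u s) + conv (fox (a *: x + y)) u s) =
    fun s => a%:A * (bracket x (u s) + conv (fox x) u s) + (bracket y (u s) + conv (fox y) u s).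
    by apply: SubLin; [apply: hx|apply: hy].
  apply/funext => s; rewrite bracket_linearl.
  rewrite (eq_conv (n' := fun t => a%:A * fox x t + fox y t) (m' := u)) //; last first.
    by move=> t; rewrite foxD foxZ -scalerAl mul1r.
  by rewrite conv_linl -[a *: bracket x _]mul1r -scalerAr scalerAl; ring.
- suff -> : (fun s => bracket (x * y) (u s) + conv (fox (x * y)) u s) =
    fun s => x * (bracket y (u s) + conv (fox y) u s) + y * (bracket x (u s) + conv (fox x) u s).
    by apply: submoduleD; apply: submoduleZ; [apply: hy | apply: hx].
  apply/funext => s; rewrite bracketMl.
  rewrite (eq_conv (n' := fun t => x * fox y t + y * fox x t) (m' := u)) //; last first.
    by move=> t; rewrite foxM.
  by rewrite convD !convZ; ring.
- suff -> : (fun s => bracket (bracket x y) (u s) + conv (fox (bracket x y)) u s) =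
    fun s => (bracket x (bracket y (u s) + conv (fox y) u s) +
              conv (fox x) (fun s => bracket y (u s) + conv (fox y) u s) s)
     + (-1) * (bracket y (bracket x (u s) + conv (fox x) u s) +
              conv (fox y) (fun s => bracket x (u s) + conv (fox x) u s) s).
    apply: submoduleD; first by apply: hx; apply: hy.
    by apply: submoduleZ; apply: hy; apply: hx.
  apply/funext => s.
  rewrite (eq_conv (n' := fun t => (bracket x (fox y t) - bracket y (fox x t)) +
     (conv (fox x) (fox y) t - conv (fox y) (fox x) t)) (m' := u)) //; last first.
    by move=> t; rewrite fox_bracket.
  rewrite convD !convB !convDr !bracketDr !bracket_conv !convA (jacobi_der x y).
  ring.
Qed.

Lemma fox_image_submodule (phi : P -> P) (w1 w2 : seq 'I_2 -> P) :
    poisson_morphism phi ->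
    (forall i, submodule bk w1 w2 (fox (phi (pvar k i)))) ->
  forall p, submodule bk w1 w2 (fox (phi p)).
Proof.
move=> phiP vars p.
elim: (freePoisson_generated p) => {p} [_ [i ->]||a x y _ hx _ hy
  |x y _ hx _ hy|x y _ hx _ hy] //.
- rewrite (pmorph1 phiP); suff -> : fox (1 : P) = fun=> 0 by apply: submodule0.
  by apply/funext => s; rewrite fox1.
- suff -> : fox (phi (a *: x + y)) = fun s => a%:A * fox (phi x) s + fox (phi y) s.
    exact: SubLin.
  apply/funext => s; rewrite (pmorphD phiP) (pmorphZ phiP) foxD foxZ.
  by rewrite -scalerAl mul1r.
- suff -> : fox (phi (x * y)) = fun s => phi x * fox (phi y) s + phi y * fox (phi x) s.
    by apply: submoduleD; apply: submoduleZ.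
  by apply/funext => s; rewrite (pmorphM phiP) foxM.
- suff -> : fox (phi (bracket x y)) =
     fun s => (bracket (phi x) (fox (phi y) s) + conv (fox (phi x)) (fox (phi y)) s)
     + (-1) * (bracket (phi y) (fox (phi x) s) + conv (fox (phi y)) (fox (phi x)) s).
    apply: submoduleD; first exact: submodule_hact.
    by apply: submoduleZ; apply: submodule_hact.
  by apply/funext => s; rewrite (pmorph_bracket phiP) fox_bracket; ring.
Qed.

Theorem automorphism_polysub (phi : P -> P) : poisson_automorphism phi ->
  forall i, polysub (phi (pvar k i)).
Proof.
move=> [phiP [psi psiK phiK]] i.
pose w j := fox (phi (pvar k j)).
(* Surjectivity of [phi]: a letter is the differential of a variable, which is an image. *)
have sub j : submodule bk (w ord0) (w ord_max) (letter P j).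
  have -> : letter P j = fox (phi (psi (pvar k j))).
    by apply/funext => s; rewrite phiK fox_pvar.
  apply: (fox_image_submodule phiP) => l.
  have [->|l0] := eqVneq l ord0; first exact: SubL.
  suff -> : l = ord_max by apply: SubR.
  by apply/val_inj; case: l l0 => -[|[|l]].
have [d1 b1] := liespan_bounded (fox_liespan (phi (pvar k ord0))).
have [d2 b2] := liespan_bounded (fox_liespan (phi (pvar k ord_max))).
have [||b1' b2'] := @liespan_letters _ _ _ bk char0 (freePoisson_domain char0)
  (fun i => bracketDr (pvar k i)) (fun i => bracket_leibniz (pvar k i)) ord0 ord_max isT
  d1 d2 _ _ (fox_liespan _) (fox_liespan _) _ _ sub.
- by move=> s ls; apply: b1; apply: ltnW.
- by move=> s ls; apply: b2; apply: ltnW.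
apply: (polysub_fox char0) => s ls.
have [->|i0] := eqVneq i ord0; first exact: b1'.
suff -> : i = ord_max by apply: b2'.
by apply/val_inj; case: i i0 => -[|[|i]].
Qed.

End PolynomialImages.

(** * Bivariate polynomials and their evaluation *)

Section BivariateEvaluation.
Variables (k : fieldType) (A : comNzRingType) (h : {rmorphism k -> A}) (a b : A).

Definition eval1 : {rmorphism {poly k} -> A} :=
  horner_morph (fun c => mulrC a (h c)).

(* The inner variable is sent to [a], the outer one to [b]. *)
Definition eval2 : {rmorphism {poly {poly k}} -> A} :=
  horner_morph (fun c => mulrC b (eval1 c)).

Lemma eval2C c : eval2 c%:P%:P = h c.
Proof. by rewrite /eval2 /= horner_morphC /= horner_morphC. Qed.

Lemma eval2X : eval2 'X%:P = a.
Proof. by rewrite /eval2 /= horner_morphC /= horner_morphX. Qed.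

Lemma eval2Y : eval2 'X = b.
Proof. by rewrite /eval2 /= horner_morphX. Qed.

End BivariateEvaluation.

Lemma bivariate_ind (k : fieldType) (S : {poly {poly k}} -> Prop) :
    (forall c, S c%:P%:P) -> S 'X%:P -> S 'X ->
    (forall p q, S p -> S q -> S (p + q)) ->
    (forall p q, S p -> S q -> S (p * q)) ->
  forall p, S p.
Proof.
move=> SC SX SY SD SM p.
have S1 (q : {poly k}) : S q%:P.
  elim/poly_ind: q => [|q c IHq]; first exact: (SC 0).
  by rewrite polyCD polyCM; apply: SD; [apply: SM|apply: SC].
elim/poly_ind: p => [|p c IHp]; first exact: (S1 0).
by apply: SD; [apply: SM|].
Qed.

(** * Derivatives and multiplicities over a domain of characteristic zero *)

Section PolynomialLemmas.
Variable R : idomainType.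
Implicit Types p q : {poly R}.

Lemma coefM_top p q a b : (size p <= a.+1)%N -> (size q <= b.+1)%N ->
  (p * q)`_(a + b) = p`_a * q`_b.
Proof.
move=> pa qb; rewrite coefM.
have lt : (a < (a + b).+1)%N by rewrite ltnS leq_addr.
rewrite (bigD1 (Ordinal lt)) //= addKn big1 ?addr0 // => i ia.
have [lt'|le'] := ltnP a i; first by rewrite nth_default ?mul0r // (leq_trans pa).
rewrite [q`_ _]nth_default ?mulr0 // (leq_trans qb) //.
have : (i != a :> nat) by apply: contra ia => /eqP E; apply/eqP/val_inj.
by move: le'; lia.
Qed.

Lemma sizeM_bound p q a b : (size p <= a.+1)%N -> (size q <= b.+1)%N ->
  (size (p * q)%R <= (a + b).+1)%N.
Proof. by move=> pa qb; apply: leq_trans (size_polyMleq _ _) _; lia. Qed.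

Lemma sizeX_bound p a j : (size p <= a.+1)%N -> (size (p ^+ j)%R <= (a * j).+1)%N.
Proof.
move=> pa; elim: j => [|j IHj]; first by rewrite expr0 muln0 size_poly1.
by rewrite exprS mulnS; apply: sizeM_bound.
Qed.

Lemma coefX_top p a j : (size p <= a.+1)%N -> (p ^+ j)`_(a * j) = p`_a ^+ j.
Proof.
move=> pa; elim: j => [|j IHj]; first by rewrite !expr0 muln0 coef1.
by rewrite !exprS mulnS coefM_top ?IHj //; apply: sizeX_bound.
Qed.

Hypothesis natR : forall n, n.+1%:R != 0 :> R.

Lemma natr_inj_idomain m n : m%:R = n%:R :> R -> m = n.
Proof.
wlog le : m n / (m <= n)%N => [H|].
  by have [|/ltnW] := leqP m n; [apply: H | move=> le /esym /(H _ _ le)].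
move/eqP; rewrite eq_sym -subr_eq0 -natrB // => /eqP E.
case d : (n - m)%N E => [|e] E; first by lia.
by have := natR e; rewrite E eqxx.
Qed.

(** After multiplication by ['X], the top coefficients of the two sides are the product of the
    leading coefficients times the degree of [p] and of [q] respectively. *)
Lemma deriv_eq_size p q : p != 0 -> q != 0 -> p^`() * q = p * q^`() ->
  size p = size q.
Proof.
move=> p0 q0 E.
have szX (r : {poly R}) : r != 0 -> (size (('X : {poly R}) * r^`())%R <= (size r).-1.+1)%N /\
   ('X * r^`())`_(size r).-1 = (size r).-1%:R * lead_coef r.
  move=> r0; split.
    apply: leq_trans (size_polyMleq _ _) _; rewrite size_polyX add2n.
    by have := lt_size_deriv r0; have := size_poly_gt0 r; rewrite r0; lia.
  rewrite coefXM lead_coefE; case: (size r).-1 => [|d] /=; first by rewrite mul0r.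
  by rewrite coef_deriv mulr_natl.
have [sp cp] := szX p p0; have [sq cq] := szX q q0.
have bnd (r : {poly R}) : (size r <= (size r).-1.+1)%N by lia.
have := coefM_top sp (bnd q); rewrite -mulrA E mulrCA.
rewrite (coefM_top (bnd p) sq) cp cq -!lead_coefE mulrCA -mulrA.
have lpq0 : lead_coef p * lead_coef q != 0 by rewrite mulf_neq0 ?lead_coef_eq0.
move=> /(mulIf lpq0)/natr_inj_idomain E'.
by move: p0 q0; rewrite -!size_poly_gt0; lia.
Qed.

(** The difference [r] satisfies the same equation with [p] but has a smaller size, so
    [deriv_eq_size] forces it to vanish. *)
Lemma deriv_eq_proportional p q : p != 0 -> q != 0 -> p^`() * q = p * q^`() ->
  lead_coef p *: q = lead_coef q *: p.
Proof.
move=> p0 q0 E; have sz := deriv_eq_size p0 q0 E.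
apply/eqP; rewrite -subr_eq0; set r := _ - _; apply/negPn/negP => r0.
have rE : p^`() * r = p * r^`().
  rewrite /r derivB !derivZ !mulrBr -!scalerAr E; congr (_ - _ *: _).
  by rewrite mulrC.
have := deriv_eq_size p0 r0 rE.
have : (size r <= (size p).-1)%N.
  apply/leq_sizeP => j; rewrite leq_eqVlt => /orP[/eqP <-|lt].
    by rewrite coefB !coefZ -lead_coefE sz -lead_coefE mulrC subrr.
  have [pj qj] : (size p <= j)%N /\ (size q <= j)%N by rewrite -sz; lia.
  by rewrite coefB !coefZ !nth_default ?mulr0 ?subr0.
move=> le eq_s; move: le; rewrite -eq_s leqNgt ltn_predL => /negP; apply.
by rewrite size_poly_gt0.
Qed.

(** The value is [i!] times [H.[z]]. *)
Lemma derivn_XsubC_mult (H : {poly R}) z i : H.[z] != 0 ->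
  ((H * ('X - z%:P) ^+ i)^`(i)).[z] != 0.
Proof.
elim: i H => [|i IHi] H Hz; first by rewrite mulr1 derivn0.
rewrite derivSn derivM deriv_exp derivXsubC mul1r /=.
have -> : H^`() * ('X - z%:P) ^+ i.+1 + H * (('X - z%:P) ^+ i *+ i.+1) =
   (H^`() * ('X - z%:P) + H *+ i.+1) * ('X - z%:P) ^+ i by rewrite exprS; ring.
apply: IHi; rewrite !hornerE hornerMn subrr mulr0 add0r -mulr_natl.
exact: mulf_neq0.
Qed.

(** Up to a power of ['X], [q] is a polynomial [s] in ['X^d]. If [z ^+ d] is a root of [s] of
    multiplicity [i], then [('X^d - z^d)^i] divides [q], while [z] is a root of [q] of multiplicity
    just [i]. *)
Lemma lacunary_multiplicity (q : {poly R}) z d : q != 0 -> z != 0 -> (0 < d)%N ->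
    (forall b b', q`_b != 0 -> q`_b' != 0 -> b = b' %[mod d]) ->
  exists i, (i * d <= (size q).-1)%N /\ (q^`(i)).[z] != 0.
Proof.
move=> q0 z0 d0 lac; set r := ((size q).-1 %% d)%N.
have qr b : q`_b != 0 -> (b %% d = r)%N.
  by move=> qb; apply: lac => //; rewrite -lead_coefE lead_coef_eq0.
pose s := \poly_(j < size q) q`_(r + d * j).
have rd : (r < d)%N by rewrite ltn_mod.
have qE : q = 'X^r * (s \Po 'X^d).
  apply/polyP => b; rewrite coefXnM; case: ltnP => rb.
    apply/eqP/negPn/negP => /qr br; have := leq_mod b d; rewrite br; lia.
  rewrite coef_comp_poly_Xn //; case: dvdnP => [[j bj]|nd].
    rewrite bj mulnK // coef_poly.
    have -> : b = (r + d * j)%N by rewrite mulnC -bj subnKC.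
    case: ltnP => // sj; rewrite nth_default // (leq_trans sj) //.
    by rewrite (leq_trans _ (leq_addl _ _)) // leq_pmull.
  apply/eqP/negPn/negP => /qr br; case: nd; exists (b %/ d)%N.
  by rewrite {1}(divn_eq b d) br addnK.
have s0 : s != 0 by apply/eqP => s0; move: q0; rewrite qE s0 comp_poly0 mulr0 eqxx.
have [i [s1 /implyP/(_ s0) s1z sE]] := multiplicity_XsubC s (z ^+ d).
(* The cofactor of ['X - z] in ['X^d - z^d]; its value [d z^(d-1)] at [z] is nonzero, so [z] is a
   simple root. *)
pose h : {poly R} := \sum_(l < d) 'X ^+ (d.-1 - l) * z%:P ^+ l.
have hE : 'X^d - (z ^+ d)%:P = ('X - z%:P) * h by rewrite -subrXX polyC_exp.
have hz : h.[z] != 0.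
  have -> : h.[z] = d%:R * z ^+ d.-1.
    rewrite horner_sum (eq_bigr (fun=> z ^+ d.-1)) => [|l _].
      by rewrite sumr_const card_ord mulr_natl.
    rewrite hornerM !horner_exp hornerX hornerC -exprD subnK //.
    by have := ltn_ord l; lia.
  by case: (d) d0 => // d' _; rewrite mulf_neq0 // expf_neq0.
pose H := 'X^r * (s1 \Po 'X^d) * h ^+ i.
have qH : q = H * ('X - z%:P) ^+ i.
  rewrite qE sE rmorphM rmorphXn /= rmorphB /= comp_polyX comp_polyC hE exprMn /H.
  by ring.
have Hz : H.[z] != 0.
  rewrite /H !hornerM horner_comp !hornerXn horner_exp.
  by rewrite !mulf_neq0 // expf_neq0.
exists i; split; last by rewrite qH; apply: derivn_XsubC_mult.
have q2 : q = 'X^r * (s1 \Po 'X^d) * ('X^d - (z ^+ d)%:P) ^+ i.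
  by rewrite qE sE rmorphM rmorphXn /= rmorphB /= comp_polyX comp_polyC; ring.
have /dvdp_leq := dvdp_mull ('X^r * (s1 \Po 'X^d)) (dvdpp (('X^d - (z ^+ d)%:P) ^+ i)).
rewrite -q2 => /(_ q0).
have := size_exp ('X^d - (z ^+ d)%:P) i; rewrite size_XnsubC //= => sE'.
by move=> le; rewrite mulnC -sE' -!subn1 leq_sub2r.
Qed.

End PolynomialLemmas.

(** * Substitution in bivariate polynomials *)

Section PolynomialSubstitution.
Variable k : fieldType.
Notation C := {poly {poly k}}.

Definition pconst : {rmorphism k -> C} := polyC \o polyC.

Definition ev (f g G : C) : C := eval2 pconst f g G.

Variables f g : C.

Lemma evC c : ev f g c%:P%:P = c%:P%:P. Proof. exact: eval2C. Qed.

Lemma evX : ev f g 'X%:P = f. Proof. exact: eval2X. Qed.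

Lemma evY : ev f g 'X = g. Proof. exact: eval2Y. Qed.

Lemma evD G H : ev f g (G + H) = ev f g G + ev f g H.
Proof. exact: rmorphD. Qed.

Lemma evM G H : ev f g (G * H) = ev f g G * ev f g H.
Proof. exact: rmorphM. Qed.

Lemma ev0 : ev f g 0 = 0. Proof. exact: rmorph0. Qed.

Lemma ev1 : ev f g 1 = 1. Proof. exact: rmorph1. Qed.

Lemma evN (G : C) : ev f g (- G) = - ev f g G.
Proof. exact: rmorphN. Qed.

Lemma evXn (G : C) j : ev f g (G ^+ j) = ev f g G ^+ j.
Proof. exact: rmorphXn. Qed.

Lemma poly_expand (R : nzRingType) (p : {poly R}) K : (size p <= K)%N ->
  p = \sum_(i < K) (p`_i)%:P * 'X^i.
Proof.
move=> sp; rewrite (eq_bigr (fun i : 'I_K => p`_i *: 'X^i)); last first.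
  by move=> i _; rewrite mul_polyC.
rewrite -poly_def; apply/polyP => i; rewrite coef_poly.
by case: ltnP => // Ki; rewrite nth_default // (leq_trans sp).
Qed.

Lemma ev_expand (G : C) K :
  (size G <= K)%N -> (forall b : nat, (size (G`_b)%R <= K)%N) ->
  ev f g G = \sum_(b < K) \sum_(a < K) ((G`_b)`_a)%:P%:P * f ^+ a * g ^+ b.
Proof.
move=> sG sGb; rewrite {1}(poly_expand sG).
rewrite (big_morph (ev f g) evD ev0); apply: eq_bigr => b _.
rewrite evM evXn evY {1}(poly_expand (sGb b)) rmorph_sum.
rewrite (big_morph (ev f g) evD ev0) mulr_suml; apply: eq_bigr => a _.
by rewrite /= polyCM polyC_exp evM evXn evX evC.
Qed.

End PolynomialSubstitution.

(** * Jacobians of pairs of polynomials *)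

Section PlaneJacobian.
Variable k : fieldType.
Notation C := {poly {poly k}}.
Implicit Types p q : C.

Definition deriv_in p : C := map_poly (@deriv k) p.

Lemma coef_deriv_in p i : (deriv_in p)`_i = (p`_i)^`().
Proof. by rewrite /deriv_in coef_map_id0 // deriv0. Qed.

Lemma deriv_inD p q : deriv_in (p + q) = deriv_in p + deriv_in q.
Proof. by apply/polyP => i; rewrite coefD !coef_deriv_in coefD derivD. Qed.

Lemma deriv_inM p q : deriv_in (p * q) = deriv_in p * q + p * deriv_in q.
Proof.
apply/polyP => i; rewrite coefD coef_deriv_in !coefM.
rewrite (big_morph (fun x => x^`()) (@derivD _) (deriv0 _)) -big_split.
by apply: eq_bigr => j _; rewrite derivM !coef_deriv_in.
Qed.

Lemma deriv_inC (c : {poly k}) : deriv_in c%:P = (c^`())%:P.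
Proof.
by apply/polyP => i; rewrite coef_deriv_in !coefC; case: eqP; rewrite ?deriv0.
Qed.

Lemma deriv_inX : deriv_in 'X = 0.
Proof.
apply/polyP => i; rewrite coef_deriv_in coefX coef0.
by case: eqP => _; rewrite ?deriv0 // -polyC1 derivC.
Qed.

Lemma size_deriv_in p : (size (deriv_in p) <= size p)%N.
Proof. exact: size_poly. Qed.

Definition jac p q := deriv_in p * q^`() - p^`() * deriv_in q.

Lemma jacDr p q r : jac p (q + r) = jac p q + jac p r.
Proof. by rewrite /jac derivD deriv_inD; ring. Qed.

Lemma jacMr p q r : jac p (q * r) = jac p q * r + q * jac p r.
Proof. by rewrite /jac derivM deriv_inM; ring. Qed.

Lemma jacC p q : jac p q = - jac q p.
Proof. by rewrite /jac; ring. Qed.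

Lemma jacCr p c : jac p c%:P%:P = 0.
Proof. by rewrite /jac derivC deriv_inC derivC !mulr0 subr0. Qed.

Lemma jacxx p : jac p p = 0.
Proof. by rewrite /jac; ring. Qed.

Lemma jac_ev p f g G :
  jac p (ev f g G) = ev f g (deriv_in G) * jac p f + ev f g G^`() * jac p g.
Proof.
elim/bivariate_ind: G => [c|||G H IHG IHH|G H IHG IHH].
- by rewrite evC jacCr derivC deriv_inC derivC ev0; ring.
- by rewrite evX derivC deriv_inC derivX ev0 ev1; ring.
- by rewrite evY derivX deriv_inX ev0 ev1; ring.
- by rewrite derivD deriv_inD !evD jacDr IHG IHH; ring.
- by rewrite derivM deriv_inM !evD !evM jacMr IHG IHH; ring.
Qed.

Lemma jac_evr f g G : jac f (ev f g G) = ev f g G^`() * jac f g.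
Proof. by rewrite jac_ev jacxx; ring. Qed.

Lemma jac_ev_pair f g F G : exists K, jac (ev f g F) (ev f g G) = K * jac f g.
Proof.
exists (ev f g (deriv_in F) * ev f g G^`() - ev f g F^`() * ev f g (deriv_in G)).
by rewrite jacC jac_ev ![jac (ev _ _ _) _]jacC !jac_ev !jacxx (jacC g f); ring.
Qed.

Lemma size_jac p q a b : (size p <= a.+2)%N -> (size q <= b.+1)%N ->
  (size (jac p q) <= (a + b).+1)%N.
Proof.
move=> pa qb.
have sd (r : C) d : (size r <= d.+1)%N -> (size r^`() <= d)%N.
  move=> rd; have [->|r0] := eqVneq r 0; first by rewrite deriv0 size_poly0.
  by rewrite -ltnS (leq_trans (lt_size_deriv r0)).
apply: leq_trans (size_polyD _ _) _; rewrite size_polyN geq_max.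
apply/andP; split; last first.
  apply: sizeM_bound; first exact: sd.
  exact: leq_trans (size_deriv_in _) qb.
(* For [b = 0] the degree cannot drop by one; instead the outer derivative of [q] is zero. *)
case: b qb => [|b] qb.
  have : size q^`() = 0%N by apply/eqP; rewrite -leqn0 sd.
  by move/eqP; rewrite size_poly_eq0 => /eqP ->; rewrite mulr0 size_poly0.
rewrite addnS -addSn; apply: sizeM_bound; last exact: sd.
exact: leq_trans (size_deriv_in _) pa.
Qed.

(** The outer derivative multiplies a leading coefficient by its degree, whence the factors; the
    vanishing of this coefficient is the dependence of the leading forms. *)
Lemma coef_jac_top p q a b : (size p <= a.+2)%N -> (size q <= b.+2)%N ->
  (jac p q)`_(a + b).+1 =
    (p`_a.+1)^`() * q`_b.+1 *+ b.+1 - p`_a.+1 * (q`_b.+1)^`() *+ a.+1.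
Proof.
move=> pa qb; rewrite /jac coefB.
have sd (r : C) d : (size r <= d.+2)%N -> (size r^`() <= d.+1)%N.
  move=> rd; have [->|r0] := eqVneq r 0; first by rewrite deriv0 size_poly0.
  by rewrite -ltnS (leq_trans (lt_size_deriv r0)).
have sdi (r : C) d : (size r <= d)%N -> (size (deriv_in r) <= d)%N.
  by move=> rd; apply: leq_trans (size_deriv_in _) rd.
rewrite -{1}addSn coefM_top ?sdi ?sd // -addnS coefM_top ?sdi ?sd //.
by rewrite !coef_deriv_in !coef_deriv mulrnAr mulrnAl.
Qed.

End PlaneJacobian.

(** * Degree reduction for polynomial automorphisms of the plane *)

Section DegreeReduction.
Variable k : fieldType.
Hypothesis char0 : [pchar k] =i pred0.
Notation C := {poly {poly k}}.
Variables (f g F G : C).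
(* The plane is embedded by x = ut and y = t, with u the inner variable and t
   the outer one: the degree becomes the degree in t, and the leading form
   becomes a polynomial in u. *)
Hypothesis evF : ev f g F = 'X%:P * 'X.
Hypothesis evG : ev f g G = 'X.
(** Polynomials in [ut] and [t] have a term of degree 0 in [t] that is free of [u]. *)
Hypothesis f0 : (f`_0)^`() = 0.
Hypothesis g0 : (g`_0)^`() = 0.

Lemma natr_poly_neq0 i : i.+1%:R != 0 :> {poly k}.
Proof. by rewrite -polyC_natr polyC_eq0 natr_neq0. Qed.

(** The Jacobian of [ut] and [t] is [t], and by the chain rule it is a multiple of that of [f] and
    [g]. The latter has no term of degree 0 in [t], so its degree is exactly 1. *)
Lemma size_jacobian : size (jac f g) = 2.
Proof.
have [K E] := jac_ev_pair f g F G.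
have tE : 'X = K * jac f g.
  rewrite -E evF evG jacC jacMr jacxx mulr0 addr0 jacC /jac derivX deriv_inX.
  by rewrite deriv_inC derivX; ring.
have J0 : (jac f g)`_0 = 0.
  by rewrite /jac coefB !coef0M !coef_deriv_in f0 g0 mul0r mulr0 subr0.
have X0 : 'X != 0 :> C by rewrite polyX_eq0.
have Jn0 : jac f g != 0 by apply/eqP => J; move: X0; rewrite tE J mulr0 eqxx.
have Kn0 : K != 0 by apply/eqP => K0; move: X0; rewrite tE K0 mul0r eqxx.
have := congr1 (fun p : C => size p) tE; rewrite /= size_polyX size_mul // => sz.
have K1 : (0 < size K)%N by rewrite size_poly_gt0.
have [le1|gt1] := leqP (size (jac f g)) 1.
  by move: Jn0; rewrite (size1_polyC le1) J0 eqxx.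
move: sz K1 gt1; clear; move: (size K) (size (jac f g)) => a b; lia.
Qed.

Lemma size_f_gt1 : (1 < size f)%N.
Proof.
rewrite ltnNge; apply/negP => /size1_polyC fE.
have := size_jacobian; rewrite fE /jac deriv_inC f0 derivC mul0r mul0r subr0.
by rewrite size_poly0.
Qed.

Lemma size_g_gt1 : (1 < size g)%N.
Proof.
rewrite ltnNge; apply/negP => /size1_polyC gE.
have := size_jacobian; rewrite gE /jac deriv_inC g0 derivC !mulr0 subr0.
by rewrite size_poly0.
Qed.

Variables n m : nat.
Hypothesis size_f : size f = n.+1.
Hypothesis size_g : size g = m.+1.

Let fb : {poly k} := f`_n.
Let gb : {poly k} := g`_m.

Lemma fb_neq0 : fb != 0.
Proof.
rewrite /fb; have := lead_coefE f; rewrite size_f /= => <-.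
by rewrite lead_coef_eq0 -size_poly_gt0 size_f.
Qed.

Lemma gb_neq0 : gb != 0.
Proof.
rewrite /gb; have := lead_coefE g; rewrite size_g /= => <-.
by rewrite lead_coef_eq0 -size_poly_gt0 size_g.
Qed.

Definition box K (Q : C) := (size Q <= K)%N /\ forall b : nat, (size (Q`_b)%R <= K)%N.

Definition weight_le W (Q : C) :=
  forall a b : nat, (Q`_b)`_a != 0 -> (a * n + b * m <= W)%N.

(* The part of weight [W] of [G], evaluated at the leading form of [f], as a
   polynomial in the outer variable. *)
Definition weight_part K W (Q : C) : C :=
  \poly_(b < K) \sum_(a < K)
    if (a * n + b * m == W)%N then ((Q`_b)`_a)%:P * fb ^+ a else 0.

Lemma size_monomial (a b : nat) (c : k) :
  (size (c%:P%:P * f ^+ a * g ^+ b : C)%R <= (a * n + b * m).+1)%N.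
Proof.
rewrite (mulnC a) (mulnC b); apply: sizeM_bound; last first.
  by apply: sizeX_bound; rewrite size_g.
rewrite -[(n * a)%N]add0n; apply: sizeM_bound; first exact: size_polyC_leq1.
by apply: sizeX_bound; rewrite size_f.
Qed.

Lemma coef_monomial (a b : nat) (c : k) :
  (c%:P%:P * f ^+ a * g ^+ b : C)`_(a * n + b * m) = c%:P * fb ^+ a * gb ^+ b.
Proof.
have sf : (size f <= n.+1)%N by rewrite size_f.
have sg : (size g <= m.+1)%N by rewrite size_g.
have sc : (size (c%:P%:P : C) <= 0.+1)%N by apply: size_polyC_leq1.
rewrite (mulnC a) (mulnC b) coefM_top; last exact: sizeX_bound.
  rewrite -[(n * a)%N]add0n coefM_top //; last exact: sizeX_bound.
  by rewrite coefC /= !coefX_top.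
rewrite -[(n * a)%N]add0n; apply: sizeM_bound => //.
exact: sizeX_bound.
Qed.

(** A monomial with exponents [a] and [b] evaluates to degree [a * n + b * m], so only the part of
    weight [W] reaches the coefficient of index [W]. *)
Lemma ev_weight K W Q : box K Q -> weight_le W Q ->
  (size (ev f g Q) <= W.+1)%N /\ (ev f g Q)`_W = (weight_part K W Q).[gb].
Proof.
move=> [sG sGb] wG; rewrite (ev_expand f g sG sGb); split.
  apply: (leq_trans (size_sum _ _ _)); apply/bigmax_leqP => b _.
  apply: (leq_trans (size_sum _ _ _)); apply/bigmax_leqP => a _.
  have [->|c0] := eqVneq ((Q`_b)`_a) 0; first by rewrite !polyC0 !mul0r size_poly0.
  by apply: leq_trans (size_monomial _ _ _) _; rewrite ltnS; apply: wG.
rewrite /weight_part horner_poly coef_sum; apply: eq_bigr => b _.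
rewrite coef_sum mulr_suml; apply: eq_bigr => a _.
case: eqP => [<-|ne]; first exact: coef_monomial.
rewrite mul0r; have [->|c0] := eqVneq ((Q`_b)`_a) 0.
  by rewrite !polyC0 !mul0r coef0.
apply: nth_default; apply: leq_trans (size_monomial _ _ _) _.
by have := wG _ _ c0; rewrite leq_eqVlt => /orP[/eqP|].
Qed.

Lemma box_deriv K (Q : C) : box K Q -> box K Q^`().
Proof.
move=> [sG sGb]; split=> [|b].
  have [->|G0] := eqVneq Q 0; first by rewrite deriv0 size_poly0.
  exact: leq_trans (ltnW (lt_size_deriv G0)) sG.
rewrite coef_deriv -scaler_nat; exact: leq_trans (size_scale_leq _ _) (sGb _).
Qed.

Lemma weight_deriv W (Q : C) : weight_le W Q -> weight_le (W - m)%N Q^`().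
Proof.
move=> wG a b; rewrite coef_deriv coefMn => c0.
have /wG : (Q`_b.+1)`_a != 0 by apply: contra c0 => /eqP ->; rewrite mul0rn.
by move: (a * n)%N => x; lia.
Qed.

Lemma weight_part_deriv K W (Q : C) : box K Q -> (m <= W)%N ->
  weight_part K (W - m)%N Q^`() = (weight_part K W Q)^`().
Proof.
move=> [sG sGb] mW; apply/polyP => b.
rewrite coef_deriv [LHS]coef_poly [X in X *+ _]coef_poly.
have E a : (a * n + b * m == W - m)%N = (a * n + b.+1 * m == W)%N.
  by move: (a * n)%N => x; lia.
case: (ltnP b.+1 K) => bK.
  rewrite (ltnW bK) -sumrMnl; apply: eq_bigr => a _.
  by rewrite E; case: eqP => _; rewrite ?mul0rn // coef_deriv coefMn polyCMn mulrnAl.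
rewrite mul0rn; case: ltnP => // _; apply: big1 => a _.
rewrite coef_deriv [Q`_b.+1]nth_default ?(leq_trans sG) // mul0rn coef0 mul0r.
by case: eqP.
Qed.

(** Taking the Jacobian with [f] adds at most [n - 1] to the degree, and cancelling the Jacobian of
    [f] and [g] removes 1. *)
Lemma size_ev_deriv Q : (1 < n)%N ->
  (size (ev f g Q^`()) <= size (ev f g Q) + n - 2)%N \/ ev f g Q^`() = 0.
Proof.
move=> n1; have [->|h'0] := eqVneq (ev f g Q^`()) 0; [by right|left].
have J2 := size_jacobian.
have E := jac_evr f g Q.
have J0 : jac f g != 0 by rewrite -size_poly_gt0 J2.
have := size_mul h'0 J0; rewrite -E J2 addn2 /= => sz.
have h0 : ev f g Q != 0.
  apply/eqP => h0; move/eqP: E; rewrite h0 /jac /deriv_in deriv0 map_poly0 !mulr0 subr0.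
  by rewrite eq_sym mulf_eq0 (negbTE h'0) (negbTE J0).
case: n n1 size_f => [|[|n']] // _ sf.
have sf2 : (size f <= n'.+1.+2)%N by rewrite sf.
have : (size (ev f g Q) <= (size (ev f g Q)).-1.+1)%N by rewrite leqSpred.
move/(size_jac sf2); rewrite sz.
move: h0; rewrite -size_poly_gt0.
by move: (size (ev f g Q)) (size (ev f g Q^`())) => a b; lia.
Qed.

(* As [jac f (ev f g Q)] is [ev f g Q^`()] times the Jacobian of [f] and [g],
   every derivative of [Q] costs at most [n - 2] in degree and [m] in weight. *)
Lemma weight_estimate K W Q i : (1 < n)%N -> box K Q -> weight_le W Q ->
  (i * m <= W)%N -> ((weight_part K W Q)^`(i)).[gb] != 0 ->
  (W < size (ev f g Q) + i * (n + m - 2))%N.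
Proof.
move=> n1; have m0 : (0 < m)%N.
  by have := size_g_gt1; rewrite size_g.
elim: i W Q => [|i IHi] W Q bG wG iW qi.
  have [_ cW] := ev_weight bG wG.
  rewrite mul0n addn0 ltnNge; apply/negP => le.
  by move: qi; rewrite derivn0 -cW nth_default // eqxx.
have mW : (m <= W)%N by move: iW; rewrite mulSn; move: (i * m)%N => x; lia.
have := IHi _ _ (box_deriv bG) (weight_deriv wG).
rewrite weight_part_deriv // -derivSn => /(_ _ qi) H.
have {}H : (W - m < size (ev f g Q^`()) + i * (n + m - 2))%N.
  by apply: H; move: iW; rewrite mulSn; move: (i * m)%N => x; lia.
rewrite mulSn; move: H; move: (i * _)%N => x.
have [|->] := size_ev_deriv Q n1; last first.
  by rewrite size_poly0; move: (size _) => a; lia.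
by move: (size (ev f g Q^`())) (size (ev f g Q)) => a b; lia.
Qed.

Lemma top_weight K (Q : C) : Q != 0 -> box K Q -> exists W a b,
  [/\ weight_le W Q, (a * n + b * m = W)%N & (Q`_b)`_a != 0].
Proof.
move=> G0 [sG sGb].
have lt a b : (Q`_b)`_a != 0 -> (a < K)%N /\ (b < K)%N.
  move=> c0; split; rewrite ltnNge; apply: contra c0 => le.
    by rewrite nth_default // (leq_trans (sGb b)).
  by rewrite [Q`_b]nth_default ?coef0 // (leq_trans sG).
have [b0 [a0 c0]] : exists b a, (Q`_b)`_a != 0.
  exists (size Q).-1, (size (Q`_(size Q).-1)).-1.
  by rewrite -lead_coefE -lead_coefE !lead_coef_eq0.
have [a0K b0K] := lt _ _ c0.
pose Pr (ab : 'I_K * 'I_K) := (Q`_ab.2)`_ab.1 != 0.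
have P0 : Pr (Ordinal a0K, Ordinal b0K) by [].
case: (@arg_maxnP _ (Ordinal a0K, Ordinal b0K) Pr (fun ab => (ab.1 * n + ab.2 * m)%N) P0).
move=> [a b] /= cab mx; exists (a * n + b * m)%N, a, b; split=> // a' b' c'.
have [a'K b'K] := lt _ _ c'.
exact: (mx (Ordinal a'K, Ordinal b'K)).
Qed.

Lemma degree_dvd : (n <= m)%N -> (n %| m)%N.
Proof.
move=> nm; apply: contraT => ndvd.
have n1 : (1 < n)%N.
  have := size_f_gt1; rewrite size_f ltnS => n0.
  by case: (n) n0 ndvd => [|[|n']] //; rewrite dvd1n.
pose K := (size G + \max_(b < size G) size (G`_b)%R)%N.
have bG : box K G.
  split=> [|b]; first exact: leq_addr.
  have [lt|le] := ltnP b (size G); last by rewrite nth_default ?size_poly0.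
  apply: leq_trans (leq_addl _ _).
  exact: (@leq_bigmax _ (fun b : 'I_(size G) => size (G`_b)%R) (Ordinal lt)).
have G0 : G != 0.
  by apply/eqP => G0; move/eqP: evG; rewrite G0 ev0 eq_sym polyX_eq0.
have [W [a [b [wG abW c0]]]] := top_weight G0 bG.
set q := weight_part K W G.
have coefq b' : q`_b' != 0 -> exists a', (a' * n + b' * m = W)%N.
  rewrite coef_poly; case: ltnP => [_|]; last by rewrite eqxx.
  move=> sn0; apply: contrapT => na; move/eqP: sn0; apply; apply: big1 => a' _.
  by case: eqP => // E; case: na; exists a'.
have q0 : q != 0.
  apply/eqP => q0; have : q`_b = 0 by rewrite q0 coef0.
  have bK : (b < K)%N.
    rewrite ltnNge; apply: contra c0 => le.
    by rewrite [G`_b]nth_default ?coef0 // (leq_trans (proj1 bG)).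
  have aK : (a < K)%N.
    rewrite ltnNge; apply: contra c0 => le.
    by rewrite nth_default // (leq_trans (proj2 bG b)).
  (* As [n > 0], the exponent [b] and the weight [W] determine [a], so nothing cancels in this
     coefficient. *)
  rewrite coef_poly bK (bigD1 (Ordinal aK)) //= abW eqxx big1 => [|a' a'a].
    rewrite addr0 => /eqP; rewrite mulf_eq0 polyC_eq0 (negbTE c0) /=.
    by rewrite expf_eq0 (negbTE fb_neq0) andbF.
  case: eqP => // E; move/eqP: a'a => []; apply/val_inj => /=.
  by move: E; rewrite -abW => /addIn /eqP; rewrite eqn_pmul2r ?(ltnW n1) // => /eqP.
set d := (n %/ gcdn n m)%N.
have g_gt0 : (0 < gcdn n m)%N by rewrite gcdn_gt0 (ltnW n1).
have nE : (d * gcdn n m = n)%N by rewrite divnK ?dvdn_gcdl.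
have mE : (m %/ gcdn n m * gcdn n m = m)%N by rewrite divnK ?dvdn_gcdr.
have d1 : (1 < d)%N.
  have d0 : (0 < d)%N by move: n1; rewrite -nE; case: (d).
  rewrite ltn_neqAle d0 andbT; apply: contra ndvd => /eqP d1.
  by rewrite -nE -d1 mul1n dvdn_gcdr.
have dcop : coprime d (m %/ gcdn n m).
  rewrite /coprime -(eqn_pmul2r g_gt0) muln_gcdl nE mE mul1n.
  by [].
(* Equal weights make [(b2 - b1) * m] a multiple of [n]; division by the gcd leaves [d], which is
   coprime to the quotient of [m]. *)
have lac b1 b2 : q`_b1 != 0 -> q`_b2 != 0 -> b1 = b2 %[mod d].
  wlog le : b1 b2 / (b1 <= b2)%N => [H q1 q2|].
    by have [/H|/ltnW/H] := leqP b1 b2; [apply | move=> E; apply/esym/E].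
  move=> /coefq[a1 E1] /coefq[a2 E2]; apply/eqP; rewrite eq_sym eqn_mod_dvd //.
  rewrite -(Gauss_dvdl _ dcop) -(dvdn_pmul2r g_gt0) nE -mulnA mE mulnBl.
  have a21 : (a2 * n <= a1 * n)%N.
    by have : (b1 * m <= b2 * m)%N by [rewrite leq_mul2r le orbT]; lia.
  have -> : (b2 * m - b1 * m = (a1 - a2) * n)%N by rewrite mulnBl; lia.
  exact: dvdn_mull.
have [i [iq qi]] := lacunary_multiplicity natr_poly_neq0 q0 gb_neq0 (ltnW d1) lac.
have [a1 E1] : exists a', (a' * n + (size q).-1 * m = W)%N.
  by apply: coefq; rewrite -lead_coefE lead_coef_eq0.
have idW : (i * d * m <= W)%N.
  by rewrite -E1 (leq_trans _ (leq_addl _ _)) // leq_mul2r iq orbT.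
have imW : (i * m <= W)%N.
  by apply: leq_trans idW; rewrite leq_mul2r leq_pmulr ?orbT // ltnW.
have := weight_estimate n1 bG wG imW qi; rewrite evG size_polyX.
have [sW _] := ev_weight bG wG; move: sW; rewrite evG size_polyX ltnS => W0.
(* Multiplicity zero would give weight 1, whereas all nonzero weights are at least [n > 1]. *)
case: i {iq qi imW} idW => [|i] idW.
  rewrite mul0n addn0 => W1; have {W0 W1} W1 : W = 1%N by lia.
  move: abW; rewrite W1; clear -n1 nm.
  by case: a => [|a]; case: b => [|b]; rewrite ?mul0n ?mulSn; lia.
(* With positive multiplicity [i.+1], [d >= 2] gives this lower bound and the estimate gives
   [W < 2 + i.+1 * (n + m - 2)]. Since [n <= m], they leave [2 * i.+1 < 2]. *)
have iW : (i.+1 * (2 * m) <= W)%N.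
  by rewrite mulnA (leq_trans _ idW) // leq_mul2r leq_mul2l d1 !orbT.
rewrite -[2%R]/2%N => lt.
have l1 : (i.+1 * (2 * m) < 2 + i.+1 * (n + m - 2))%N by apply: leq_ltn_trans iW lt.
have l2 : (i.+1 * (n + m - 2) <= i.+1 * (2 * m - 2))%N by rewrite leq_mul2l; lia.
have l3 : (i.+1 * (2 * m) = i.+1 * (2 * m - 2) + i.+1 * 2)%N.
  by rewrite -mulnDr; congr (_ * _)%N; lia.
by move: l1 l2 l3; clear; lia.
Qed.

Theorem degree_reduction : (n <= m)%N -> (2 < n + m)%N ->
  exists (c : k) (q : nat), (size (g - c%:P%:P * f ^+ q : C)%R < size g)%N.
Proof.
move=> nm nm2; have /dvdnP[q mE] := degree_dvd nm.
have n0 : (0 < n)%N by have := size_f_gt1; rewrite size_f.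
have m0 : (0 < m)%N := leq_trans n0 nm.
have J2 := size_jacobian.
(* The Jacobian has degree 1 in [t], below [n + m - 1], so the coefficient of [coef_jac_top] is
   zero. *)
have E : fb^`() * gb *+ m = fb * gb^`() *+ n.
  have [n' nE] : exists n', n = n'.+1 by exists n.-1; rewrite prednK.
  have [m' m'E] : exists m', m = m'.+1 by exists m.-1; rewrite prednK.
  have := @coef_jac_top k f g n' m'; rewrite size_f size_g nE m'E !ltnS !leqnn.
  move=> /(_ isT isT); rewrite nth_default; last by rewrite J2; lia.
  by rewrite -nE -m'E => /esym/eqP; rewrite subr_eq0 => /eqP.
have fq0 : fb ^+ q != 0 by rewrite expf_neq0 // fb_neq0.
have q0 : (0 < q)%N by move: m0; rewrite mE; case: (q).
(* Dividing by [n] in [m = q * n] turns the relation into equality of the logarithmic derivatives of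
   [fb ^+ q] and [gb]. *)
have E2 : (fb ^+ q)^`() * gb = fb ^+ q * gb^`().
  have E1 : fb^`() * gb *+ q = fb * gb^`().
    have : n%:R * (fb^`() * gb *+ q - fb * gb^`()) = 0.
      by rewrite mulrBr !mulr_natl -mulrnA -mE E subrr.
    case: (n) n0 => // n' _ /eqP; rewrite mulf_eq0 (negbTE (natr_poly_neq0 _)) /=.
    by rewrite subr_eq0 => /eqP.
  rewrite deriv_exp; case: (q) q0 E1 => // q' _ E1.
  by rewrite exprSr -[RHS]mulrA -E1 /= mulrnAl mulrnAr mulrAC [X in X *+ _]mulrC.
have := deriv_eq_proportional (natr_neq0 char0) fq0 gb_neq0 E2.
set l := lead_coef _; set r := lead_coef _ => lr.
have l0 : l != 0 by rewrite lead_coef_eq0.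
exists (r / l), q; rewrite size_g ltnS.
have cf : gb = (r / l)%:P * fb ^+ q.
  by rewrite mul_polyC mulrC -scalerA -lr scalerA mulVf // scale1r.
have sfq : (size (f ^+ q)%R <= m.+1)%N.
  by rewrite mE mulnC; apply: sizeX_bound; rewrite size_f.
have s2 : (size ((r / l)%:P%:P * f ^+ q : C)%R <= m.+1)%N.
  by rewrite -[m]add0n; apply: sizeM_bound => //; apply: size_polyC_leq1.
apply/leq_sizeP => j; rewrite leq_eqVlt => /orP[/eqP <-|lt].
  rewrite coefB coefCM mE mulnC coefX_top ?size_f // mulnC -mE.
  by rewrite -/fb -cf subrr.
by rewrite coefB !nth_default ?subr0 // ?(leq_trans s2) // size_g.
Qed.

End DegreeReduction.

(** * Evaluation of polynomials in commutative algebras *)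

Section PoissonEvaluation.
Variables (k : fieldType) (A : comAlgType k).
Notation B := {poly {poly k}}.
Implicit Types (a b : A) (G H : B).

Definition evP a b G : A := eval2 (in_alg A) a b G.

Lemma evPC a b c : evP a b c%:P%:P = c%:A. Proof. exact: eval2C. Qed.

Lemma evPX a b : evP a b 'X%:P = a. Proof. exact: eval2X. Qed.

Lemma evPY a b : evP a b 'X = b. Proof. exact: eval2Y. Qed.

Lemma evPD a b G H : evP a b (G + H) = evP a b G + evP a b H.
Proof. exact: rmorphD. Qed.

Lemma evPM a b G H : evP a b (G * H) = evP a b G * evP a b H.
Proof. exact: rmorphM. Qed.

Lemma evP0 a b : evP a b 0 = 0. Proof. exact: rmorph0. Qed.

Lemma evP1 a b : evP a b 1 = 1. Proof. exact: rmorph1. Qed.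

Lemma evPN a b G : evP a b (- G) = - evP a b G.
Proof. exact: rmorphN. Qed.

Lemma evPXn a b G j : evP a b (G ^+ j) = evP a b G ^+ j.
Proof. exact: rmorphXn. Qed.

Lemma evP_ev a b f g G : evP a b (ev f g G) = evP (evP a b f) (evP a b g) G.
Proof.
elim/bivariate_ind: G => [c|||G H IHG IHH|G H IHG IHH].
- by rewrite evC !evPC.
- by rewrite evX evPX.
- by rewrite evY evPY.
- by rewrite evD !evPD IHG IHH.
- by rewrite evM !evPM IHG IHH.
Qed.

End PoissonEvaluation.

(** * Total degree as the degree in one variable *)

Section Dehomogenization.
Variable k : fieldType.
Notation B := {poly {poly k}}.
Implicit Types (f g F G : B).

Lemma ev_comp a b f g G : ev a b (ev f g G) = ev (ev a b f) (ev a b g) G :> B.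
Proof.
elim/bivariate_ind: G => [c|||G H IHG IHH|G H IHG IHH].
- by rewrite !evC.
- by rewrite !evX.
- by rewrite !evY.
- by rewrite !evD IHG IHH.
- by rewrite !evM IHG IHH.
Qed.

Definition dehom G : B := ev ('X%:P * 'X) 'X G.

Lemma dehomD G H : dehom (G + H) = dehom G + dehom H.
Proof. exact: evD. Qed.

Lemma dehomM G H : dehom (G * H) = dehom G * dehom H.
Proof. exact: evM. Qed.

Lemma coef_dehomC (c : {poly k}) i j :
  ((dehom c%:P)`_j)`_i = if i == j then c`_i else 0.
Proof.
elim/poly_ind: c i j => [|c d IHc] i j.
  by rewrite /dehom polyC0 ev0 !coef0 if_same.
rewrite polyCD polyCM dehomD dehomM {2 3}/dehom evX evC.
rewrite mulrA !coefD coefMX !coefC coefMX.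
case: j => [|j] /=; first by rewrite coef0 add0r coefC; case: i => [|i] /=; rewrite ?add0r.
rewrite mulrC coefCM mulrC coefMX coef0 !addr0; case: i => [|i] //=.
by rewrite IHc eqSS ?addr0.
Qed.

(** The monomial [x^i y^l] becomes [u^i t^(i+l)], so the coefficient of [t^j] encodes the form of
    degree [j]. *)
Lemma coef_dehom G i j : ((dehom G)`_j)`_i = if (i <= j)%N then (G`_(j - i))`_i else 0.
Proof.
elim/poly_ind: G i j => [|G c IHG] i j.
  by rewrite /dehom ev0 !coef0 if_same.
rewrite dehomD dehomM {2}/dehom evY coefD coefMX coefD coef_dehomC.
rewrite coefD coefMX coefC.
case: j => [|j] /=.
  by rewrite !coef0 add0r; case: i => [|i] //=; rewrite add0r.
rewrite IHG; case: (ltngtP i j.+1) => [ij|ij|->].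
- by rewrite -ltnS ij (subSn (ij : (i <= j)%N)) /= !addr0.
- by rewrite leqNgt (ltnW ij) addr0.
- by rewrite ltnn subnn /= !add0r.
Qed.

Lemma deriv_dehom0 G : ((dehom G)`_0)^`() = 0.
Proof.
apply/polyP => i; rewrite coef_deriv coef_dehom coef0.
by rewrite mul0rn.
Qed.

Lemma dehom_linear G : (size (dehom G) <= 2)%N ->
  G = ((G`_0)`_0)%:P%:P + ((G`_0)`_1)%:P%:P * 'X%:P + ((G`_1)`_0)%:P%:P * 'X.
Proof.
move=> sG; have G0 a b : (1 < a + b)%N -> (G`_b)`_a = 0.
  move=> ab; have := coef_dehom G a (a + b).
  by rewrite leq_addr addKn => <-; rewrite [(dehom G)`_ _]nth_default ?coef0 // (leq_trans sG).
apply/polyP => b; apply/polyP => a.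
rewrite !coefD coefMX -polyCM !coefC; case: b => [|[|b]] /=.
- rewrite coef0 addr0 coefC coefMX coefC; case: a => [|[|a]] /=; rewrite ?addr0 ?add0r //.
  by rewrite G0.
- rewrite !coef0 !add0r coefC; case: a => [|a] //=.
  by rewrite G0 // addn1.
- by rewrite !coef0 !addr0 G0 // !addnS.
Qed.

End Dehomogenization.

(** * Automorphisms and tameness *)

Section FreePoissonMorphisms.
Variables (k : fieldType) (n : nat) (Q : poissonAlgType k).
Notation P := (freePoisson k n).

Lemma pmorph_ext (f g : P -> Q) : poisson_morphism f -> poisson_morphism g ->
  (forall i, f (pvar k i) = g (pvar k i)) -> f =1 g.
Proof.
move=> fP gP fg x.
rewrite (fp_lift_unique fP (v := fun i => g (pvar k i))) //.
by rewrite -(fp_lift_unique gP (v := fun i => g (pvar k i))).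
Qed.

End FreePoissonMorphisms.

Lemma pmorph_comp (k : fieldType) (P Q R : poissonAlgType k) (f : Q -> R) (g : P -> Q) :
  poisson_morphism f -> poisson_morphism g -> poisson_morphism (f \o g).
Proof.
move=> fP gP; split=> [a x y||x y] /=.
- by rewrite (pmorphD gP) (pmorphZ gP) (pmorphD fP) (pmorphZ fP).
- by split=> [|x y] /=; rewrite ?(pmorph1 gP) ?(pmorph1 fP) // (pmorphM gP) (pmorphM fP).
- by rewrite (pmorph_bracket gP) (pmorph_bracket fP).
Qed.

Lemma pauto_comp (k : fieldType) (P : poissonAlgType k) (f g : P -> P) :
  poisson_automorphism f -> poisson_automorphism g -> poisson_automorphism (f \o g).
Proof.
move=> [fP fB] [gP gB]; split; first exact: pmorph_comp.
exact: bij_comp.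
Qed.

Lemma pauto_inv (k : fieldType) (P : poissonAlgType k) (f : P -> P) :
  poisson_automorphism f ->
  exists g, [/\ poisson_automorphism g, cancel f g & cancel g f].
Proof.
move=> [fP [g gK fK]]; exists g; split=> //; split; last by exists f.
have inj := can_inj gK.
split=> [a x y||x y].
- by apply: inj; rewrite fK (pmorphD fP) (pmorphZ fP) !fK.
- by split=> [|x y]; apply: inj; rewrite ?(pmorphM fP) ?(pmorph1 fP) !fK.
- by apply: inj; rewrite (pmorph_bracket fP) !fK.
Qed.

Section Tame.
Variables (k : fieldType) (n : nat).
Notation P := (freePoisson k n).
Implicit Types (phi psi e : P -> P) (i j : 'I_n) (a : k) (f : P).

Lemma tame_eq phi psi : phi =1 psi -> tame_automorphism psi -> tame_automorphism phi.
Proof.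
by move=> E [m [e [eE psiE]]]; exists m, e; split=> // x; rewrite E psiE.
Qed.

Lemma tame_id : tame_automorphism (@idfun P).
Proof. by exists 0%N, (fun=> idfun); split=> [[]//|x]; rewrite big_ord0. Qed.

Lemma tame_elementary_comp e phi : elementary_automorphism e ->
  tame_automorphism phi -> tame_automorphism (e \o phi).
Proof.
move=> eE [m [d [dE phiE]]].
exists m.+1, (fun r : 'I_m.+1 => if unlift ord0 r is Some l then d l else e); split.
  by move=> r; case: unliftP.
move=> x; rewrite big_ord_recl unlift_none /= phiE.
by rewrite [in RHS](eq_bigr d) // => r _; rewrite liftK.
Qed.

Lemma tame_comp phi psi : tame_automorphism phi -> tame_automorphism psi ->
  tame_automorphism (phi \o psi).
Proof.
move=> [m [e [eE phiE]]] psiT.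
apply: (@tame_eq _ ((\big[comp/idfun]_(r < m) e r) \o psi)).
  by move=> x /=; rewrite phiE.
elim: m e eE {phi phiE} => [|m IHm] e eE.
  by apply: tame_eq psiT => x; rewrite big_ord0.
rewrite big_ord_recl; apply: (tame_elementary_comp (eE ord0)).
exact: IHm.
Qed.

Lemma tame_elementary e : elementary_automorphism e -> tame_automorphism e.
Proof. by move=> eE; apply: (tame_elementary_comp eE tame_id). Qed.

Definition elem i a f : P -> P :=
  fp_lift (fun j => if j == i then a *: pvar k i + f else pvar k j).

Definition free_of i : P -> Prop :=
  poisson_generated (fun y => exists2 j, j != i & y = pvar k j).

Lemma elem_morphism i a f : poisson_morphism (elem i a f).
Proof. exact: fp_lift_morphism. Qed.

Lemma elem_pvar i a f : elem i a f (pvar k i) = a *: pvar k i + f.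
Proof. by rewrite /elem fp_lift_pvar eqxx. Qed.

Lemma elem_pvar_neq i a f j : j != i -> elem i a f (pvar k j) = pvar k j.
Proof. by move=> ji; rewrite /elem fp_lift_pvar (negbTE ji). Qed.

Lemma elem_free i a f g : free_of i g -> elem i a f g = g.
Proof.
have eP := elem_morphism i a f.
elim=> {g} [x [j ji ->]||b x y _ ex _ ey|x y _ ex _ ey|x y _ ex _ ey].
- exact: elem_pvar_neq.
- exact: pmorph1.
- by rewrite (pmorphD eP) (pmorphZ eP) ex ey.
- by rewrite (pmorphM eP) ex ey.
- by rewrite (pmorph_bracket eP) ex ey.
Qed.

Lemma free_of0 i : free_of i 0.
Proof.
have := PLin (-1) (@POne k P (fun y => exists2 j, j != i & y = pvar k j))
  (@POne k P (fun y => exists2 j, j != i & y = pvar k j)).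
by rewrite scaleN1r addNr.
Qed.

Lemma free_ofD i f g : free_of i f -> free_of i g -> free_of i (f + g).
Proof. by move=> ff fg; have := PLin 1 ff fg; rewrite scale1r. Qed.

Lemma free_ofZ i a f : free_of i f -> free_of i (a *: f).
Proof. by move=> ff; have := PLin a ff (free_of0 i); rewrite addr0. Qed.

Lemma free_of_alg i a : free_of i a%:A.
Proof. by apply: free_ofZ; apply: POne. Qed.

Lemma free_of_pvar i j : j != i -> free_of i (pvar k j).
Proof. by move=> ji; apply: PGen; exists j. Qed.

Lemma free_ofX i f q : free_of i f -> free_of i (f ^+ q).
Proof.
move=> ff; elim: q => [|q IHq]; first exact: POne.
by rewrite exprS; apply: PMul.
Qed.

Lemma elemK i a f : a != 0 -> free_of i f ->
  cancel (elem i a f) (elem i a^-1 (- (a^-1 *: f))).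
Proof.
move=> a0 ff; apply: (@pmorph_ext _ _ _ (elem i a^-1 (- (a^-1 *: f)) \o elem i a f) idfun) => //.
  by apply: pmorph_comp; apply: elem_morphism.
move=> j /=; have [->|ji] := eqVneq j i; last by rewrite !elem_pvar_neq.
have eP := elem_morphism i a^-1 (- (a^-1 *: f)).
rewrite elem_pvar (pmorphD eP) (pmorphZ eP) elem_pvar (elem_free _ _ ff).
by rewrite scalerDr scalerN !scalerA mulfV // !scale1r subrK.
Qed.

Lemma elem_elementary i a f : a != 0 -> free_of i f ->
  elementary_automorphism (elem i a f).
Proof.
move=> a0 ff; split; last first.
  exists i, a, f; split=> // [j|]; [exact: elem_pvar_neq | exact: elem_pvar].
split; first exact: elem_morphism.
exists (elem i a^-1 (- (a^-1 *: f))); first exact: elemK.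
have := @elemK i a^-1 (- (a^-1 *: f)); rewrite invr_eq0 invrK => /(_ a0).
rewrite scalerN scalerA mulfV // scale1r opprK; apply.
by rewrite -scaleN1r; do 2!apply: free_ofZ.
Qed.

Lemma tame_comp_elem phi i a f : a != 0 -> free_of i f ->
  tame_automorphism (phi \o elem i a f) -> tame_automorphism phi.
Proof.
move=> a0 ff T; set e' := elem i a^-1 (- (a^-1 *: f)).
have ff' : free_of i (- (a^-1 *: f)) by rewrite -scaleN1r; do 2!apply: free_ofZ.
have a'0 : a^-1 != 0 by rewrite invr_eq0.
have e'T := tame_elementary (elem_elementary a'0 ff').
apply: tame_eq (tame_comp T e'T) => x /=; congr phi.
have := elemK a'0 ff'; rewrite invrK scalerN scalerA mulfV // scale1r opprK => K.
by rewrite K.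
Qed.

End Tame.

(** * Tameness of the automorphisms of k{x, y} *)

Section PlaneAutomorphisms.
Variable k : fieldType.
Hypothesis char0 : [pchar k] =i pred0.
Notation P := (freePoisson k 2).
Notation B := {poly {poly k}}.
Implicit Types (p q : P) (f g F G : B) (phi psi : P -> P).

Local Notation x0 := (pvar k (ord0 : 'I_2)).
Local Notation x1 := (pvar k (ord_max : 'I_2)).

Definition poly_in (G : B) : P := evP x0 x1 G.

Lemma ord2P (i : 'I_2) : i = ord0 \/ i = ord_max.
Proof.
by case: i => -[|[|i]] // lt; [left|right]; apply/val_inj.
Qed.

Lemma poly_inP p : polysub p -> exists G, p = poly_in G.
Proof.
elim=> {p} [a|i|x y _ [G ->] _ [H ->]|x y _ [G ->] _ [H ->]].
- by exists a%:P%:P; rewrite /poly_in evPC.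
- case: (ord2P i) => ->; first by exists 'X%:P; rewrite /poly_in evPX.
  by exists 'X; rewrite /poly_in evPY.
- by exists (G + H); rewrite /poly_in evPD.
- by exists (G * H); rewrite /poly_in evPM.
Qed.

Lemma fox_poly_in0 G : fox (poly_in G) [:: ord0] = poly_in (deriv_in G).
Proof.
rewrite /poly_in; elim/bivariate_ind: G => [c|||G H IHG IHH|G H IHG IHH].
- by rewrite evPC fox_alg deriv_inC derivC polyC0 evP0.
- by rewrite evPX fox_pvar deriv_inC derivX evP1.
- by rewrite evPY fox_pvar deriv_inX evP0.
- by rewrite evPD foxD deriv_inD evPD IHG IHH.
- by rewrite evPM foxM deriv_inM evPD !evPM IHG IHH; ring.
Qed.

Lemma fox_poly_in1 G : fox (poly_in G) [:: ord_max] = poly_in G^`().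
Proof.
rewrite /poly_in; elim/bivariate_ind: G => [c|||G H IHG IHH|G H IHG IHH].
- by rewrite evPC fox_alg derivC evP0.
- by rewrite evPX fox_pvar derivC evP0.
- by rewrite evPY fox_pvar derivX evP1.
- by rewrite evPD foxD derivD evPD IHG IHH.
- by rewrite evPM foxM derivM evPD !evPM IHG IHH; ring.
Qed.

Lemma deriv_eq0 (R : idomainType) (q : {poly R}) :
  (forall n, n.+1%:R != 0 :> R) -> q^`() = 0 -> q = (q`_0)%:P.
Proof.
move=> natR q'0; apply/polyP => -[|i]; rewrite coefC //=.
have := congr1 (fun r : {poly R} => r`_i) q'0; rewrite coef_deriv coef0 -mulr_natr => /eqP.
by rewrite mulf_eq0 (negbTE (natR _)) orbF => /eqP.
Qed.

Lemma size_deriv_ltn (R : nzRingType) (q : {poly R}) N :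
  (size q <= N.+1)%N -> (size q^`() <= N)%N.
Proof.
move=> sq; have [->|q0] := eqVneq q 0; first by rewrite deriv0 size_poly0.
by rewrite -ltnS (leq_trans (lt_size_deriv q0)).
Qed.

(** Algebraic independence of the variables: the partial derivatives are coefficients of [fox], so
    they inherit the relation, and in characteristic zero the induction ends at constants. *)
Lemma poly_in_eq0 G : poly_in G = 0 -> G = 0.
Proof.
have C (N : nat) : forall c : {poly k}, (size c <= N)%N -> poly_in c%:P = 0 -> c = 0.
  elim: N => [c|N IHN c sc c0]; first by rewrite leqn0 size_poly_eq0 => /eqP.
  have c'0 : c^`() = 0.
    apply: IHN (size_deriv_ltn sc) _.
    by rewrite -deriv_inC -fox_poly_in0 c0 fox0.
  have cE := deriv_eq0 (natr_neq0 char0) c'0.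
  move: c0; rewrite cE /poly_in evPC => /eqP.
  by rewrite scaler_eq0 oner_eq0 orbF => /eqP ->.
have [N] := ubnP (size G); elim: N G => // N IHN G sG G0.
have [->//|Gn0] := eqVneq G 0.
have G'0 : G^`() = 0.
  apply: IHN; last by rewrite -fox_poly_in1 G0 fox0.
  exact: leq_trans (lt_size_deriv Gn0) sG.
have nat1 i : i.+1%:R != 0 :> {poly k} by rewrite -polyC_natr polyC_eq0 natr_neq0.
have GE := deriv_eq0 nat1 G'0.
by move: G0; rewrite GE => /(C _ _ (leqnn _)) ->.
Qed.

Lemma poly_in_inj : injective poly_in.
Proof.
move=> F G FG; apply/eqP; rewrite -subr_eq0; apply/eqP/poly_in_eq0.
have E : poly_in (F - G + G) = poly_in F by rewrite subrK.
by apply: (addIr (poly_in G)); rewrite add0r -[RHS]FG -E /poly_in evPD.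
Qed.

Lemma pmorph_evP phi a b G : poisson_morphism phi ->
  phi (evP a b G) = evP (phi a) (phi b) G.
Proof.
move=> phiP; elim/bivariate_ind: G => [c|||G H IHG IHH|G H IHG IHH].
- by rewrite !evPC (pmorphZ phiP) (pmorph1 phiP).
- by rewrite !evPX.
- by rewrite !evPY.
- by rewrite !evPD (pmorphD phiP) IHG IHH.
- by rewrite !evPM (pmorphM phiP) IHG IHH.
Qed.

(** The inverse automorphism also has polynomial images [F] and [G]; these are the polynomials with
    [F(f, g) = x] and [G(f, g) = y] that the degree reduction requires. *)
Lemma automorphism_reduction phi f g : poisson_automorphism phi ->
    phi x0 = poly_in f -> phi x1 = poly_in g ->
  [/\ (1 < size (dehom f))%N, (1 < size (dehom g))%N
    & (size (dehom f) <= size (dehom g))%N -> (2 < size (dehom g))%N ->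
      exists (c : k) (q : nat),
        (size (dehom (g - c%:P%:P * f ^+ q)%R) < size (dehom g))%N].
Proof.
move=> phiA fE gE; have [psi [psiA phiK psiK]] := pauto_inv phiA.
have [F FE] := poly_inP (automorphism_polysub char0 psiA ord0).
have [G GE] := poly_inP (automorphism_polysub char0 psiA ord_max).
have phiP := proj1 phiA.
have sub H : phi (poly_in H) = poly_in (ev f g H).
  by rewrite /poly_in (pmorph_evP _ _ _ phiP) fE gE evP_ev.
have evF : ev (dehom f) (dehom g) F = 'X%:P * 'X.
  rewrite -ev_comp (_ : ev f g F = 'X%:P); first by rewrite evX.
  by apply: poly_in_inj; rewrite -sub -FE psiK /poly_in evPX.
have evG : ev (dehom f) (dehom g) G = 'X.
  rewrite -ev_comp (_ : ev f g G = 'X); first by rewrite evY.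
  by apply: poly_in_inj; rewrite -sub -GE psiK /poly_in evPY.
have f1 := size_f_gt1 evF evG (deriv_dehom0 f) (deriv_dehom0 g).
have g1 := size_g_gt1 evF evG (deriv_dehom0 f) (deriv_dehom0 g).
split=> // fg g2.
have sf : size (dehom f) = (size (dehom f)).-1.+1 by rewrite prednK // ltnW.
have sg : size (dehom g) = (size (dehom g)).-1.+1 by rewrite prednK // ltnW.
have [||c [q lt]] := degree_reduction char0 evF evG (deriv_dehom0 f) (deriv_dehom0 g) sf sg.
- by rewrite -ltnS -sf -sg.
- by move: f1 g2; move: (size _) (size _) => a b; lia.
exists c, q; apply: leq_trans lt; rewrite ltnS leq_eqVlt; apply/orP; left.
by rewrite /dehom evD evN evM evXn evC.
Qed.

Lemma automorphism_algebraic phi p a : poisson_automorphism phi ->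
  phi p = a%:A -> p = a%:A.
Proof.
move=> [phiP /bij_inj inj] E; apply: inj.
by rewrite E (pmorphZ phiP) (pmorph1 phiP).
Qed.

Lemma pvar_linear_indep (a b c : k) : a *: x0 + b *: x1 = c%:A -> a = 0 /\ b = 0.
Proof.
move=> E; have E0 := congr1 (fun p => fox p [:: ord0]) E.
have E1 := congr1 (fun p => fox p [:: ord_max]) E.
move: E0 E1; rewrite /= !foxD !foxZ !fox_pvar !fox1 /letter /=.
rewrite !scaler0 addr0 add0r => /eqP a0 /eqP b0.
by move: a0 b0; rewrite !scaler_eq0 !oner_eq0 !orbF => /eqP -> /eqP ->.
Qed.

Lemma free_of_x0 : free_of ord_max x0. Proof. exact: free_of_pvar. Qed.
Lemma free_of_x1 : free_of ord0 x1. Proof. exact: free_of_pvar. Qed.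

Definition swap : P -> P := fp_lift (fun i => if i == ord0 then x1 else x0).

Lemma swap_morphism : poisson_morphism swap.
Proof. exact: fp_lift_morphism. Qed.

Lemma swap0 : swap x0 = x1. Proof. exact: fp_lift_pvar. Qed.

Lemma swap1 : swap x1 = x0. Proof. exact: fp_lift_pvar. Qed.

Lemma swapK : involutive swap.
Proof.
apply: (pmorph_ext (f := swap \o swap) (g := idfun)) => // [|i] /=.
  by apply: pmorph_comp; apply: swap_morphism.
by case: (ord2P i) => ->; rewrite ?swap0 ?swap1 // swap0.
Qed.

Lemma swap_automorphism : poisson_automorphism swap.
Proof. split; [exact: swap_morphism | by exists swap; apply: swapK]. Qed.

Lemma swap_tame : tame_automorphism swap.
Proof.
have n1 : -1 != 0 :> k by rewrite oppr_eq0 oner_eq0.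
have f1 : free_of ord_max (- x0).
  by rewrite -scaleN1r; apply: free_ofZ; apply: free_of_x0.
(* The classical factorization of a transposition into three shears, with a change of sign. *)
pose ea := elem ord0 (-1) x1; pose eb := elem ord_max 1 (- x0); pose ec := elem ord0 1 x1.
apply: (@tame_eq _ _ _ (ea \o (eb \o ec))); last first.
  apply: tame_comp; first exact: tame_elementary (elem_elementary n1 free_of_x1).
  apply: tame_comp; first exact: tame_elementary (elem_elementary (oner_neq0 _) f1).
  exact: tame_elementary (elem_elementary (oner_neq0 _) free_of_x1).
have aP : poisson_morphism ea := elem_morphism ord0 (-1) x1.
have bP : poisson_morphism eb := elem_morphism ord_max 1 (- x0).
have cP : poisson_morphism ec := elem_morphism ord0 1 x1.
apply: pmorph_ext => [|| i]; first exact: swap_morphism.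
  by apply: pmorph_comp => //; apply: pmorph_comp.
have a0 : ea x0 = - x0 + x1 by rewrite /ea elem_pvar scaleN1r.
have a1 : ea x1 = x1 by rewrite /ea elem_pvar_neq.
have b0 : eb x0 = x0 by rewrite /eb elem_pvar_neq.
have b1 : eb x1 = x1 - x0 by rewrite /eb elem_pvar scale1r.
have c0 : ec x0 = x0 + x1 by rewrite /ec elem_pvar scale1r.
have c1 : ec x1 = x1 by rewrite /ec elem_pvar_neq.
case: (ord2P i) => -> /=.
  by rewrite swap0 c0 (pmorphD bP) b0 b1 addrC subrK a1.
rewrite swap1 c1 b1 (pmorphD aP) (pmorphN aP) a0 a1.
by rewrite opprD opprK addrCA subrr addr0.
Qed.

Lemma tame_comp_swap phi : tame_automorphism (phi \o swap) -> tame_automorphism phi.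
Proof.
move=> T; apply: tame_eq (tame_comp T swap_tame) => x /=.
by rewrite swapK.
Qed.

(** Gaussian elimination with pivot [a]; the injectivity of [phi] keeps the pivots from
    vanishing. *)
Lemma affine_tame phi (a b c a' b' c' : k) : poisson_automorphism phi ->
  phi x0 = a *: x0 + b *: x1 + c%:A -> phi x1 = a' *: x0 + b' *: x1 + c'%:A ->
  tame_automorphism phi.
Proof.
wlog a0 : phi a b c a' b' c' / a != 0 => [H phiA E0 E1|phiA E0 E1].
  have [a0|] := eqVneq a 0; last by move=> a0; apply: (H _ _ _ _ _ _ _ a0 phiA E0 E1).
  have [a'0|a'0] := eqVneq a' 0; last first.
    apply: tame_comp_swap; apply: (H _ a' b' c' a b c a'0).
    - exact: pauto_comp phiA swap_automorphism.
    - by rewrite /= swap0.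
    - by rewrite /= swap1.
  have phiP := proj1 phiA.
  (* With both coefficients of [x0] zero, this combination is sent to a scalar, so it is one itself;
     then [b = 0] and [x0] would be a scalar. *)
  have E : phi (b' *: x0 + (- b) *: x1) = (b' * c - b * c')%:A.
    rewrite (pmorphD phiP) !(pmorphZ phiP) E0 E1 a0 a'0 !scale0r !add0r.
    rewrite !scalerDr !scalerA !mulNr [b * b']mulrC scalerBl !scaleNr.
    by rewrite addrACA subrr add0r.
  have [_ /eqP] := pvar_linear_indep (automorphism_algebraic phiA E).
  rewrite oppr_eq0 => /eqP b0.
  have E0' : phi x0 = c%:A by rewrite E0 a0 b0 !scale0r !add0r.
  have x0E : 1 *: x0 + 0 *: x1 = c%:A.
    by rewrite scale1r scale0r addr0 (automorphism_algebraic phiA E0').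
  by have [/eqP] := pvar_linear_indep x0E; rewrite oner_eq0.
set r := - (a' / a).
have fr : free_of ord_max (r *: x0) by apply: free_ofZ; apply: free_of_x0.
have eA := elem_elementary (oner_neq0 k) fr.
apply: (tame_comp_elem (oner_neq0 k) fr).
set phi1 := _ \o _.
have phi1A : poisson_automorphism phi1 by apply: pauto_comp phiA (proj1 eA).
have phiP := proj1 phiA.
set d := b' + r * b; set s := c' + r * c.
have E10 : phi1 x0 = a *: x0 + b *: x1 + c%:A by rewrite /phi1 /= elem_pvar_neq.
have E11 : phi1 x1 = d *: x1 + s%:A.
  rewrite /phi1 /= elem_pvar scale1r (pmorphD phiP) (pmorphZ phiP) E0 E1.
  rewrite !scalerDr !scalerA /d /s !scalerDl.
  have -> : r * a = - a' by rewrite /r mulNr mulfVK.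
  by rewrite scaleNr; ring.
have d0 : d != 0.
  apply/eqP => d0; move: E11; rewrite d0 scale0r add0r => E11.
  have x1E : 0 *: x0 + 1 *: x1 = s%:A.
    by rewrite scale1r scale0r add0r (automorphism_algebraic phi1A E11).
  by have [_ /eqP] := pvar_linear_indep x1E; rewrite oner_eq0.
have f0 : free_of ord0 (b *: x1 + c%:A).
  by apply: free_ofD; [apply: free_ofZ; apply: free_of_x1 | apply: free_of_alg].
have f1 : @free_of k 2 ord_max s%:A by apply: free_of_alg.
apply: (@tame_eq _ _ _ (elem ord0 a (b *: x1 + c%:A) \o @elem k 2 ord_max d s%:A)); last first.
  by apply: tame_comp; apply: tame_elementary; apply: elem_elementary.
have eP := elem_morphism ord0 a (b *: x1 + c%:A).
apply: pmorph_ext => [||i]; first exact: (proj1 phi1A).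
  by apply: pmorph_comp => //; apply: elem_morphism.
case: (ord2P i) => -> /=.
  by rewrite E10 elem_pvar_neq // elem_pvar addrA.
by rewrite E11 elem_pvar (pmorphD eP) !(pmorphZ eP) (pmorph1 eP) elem_pvar_neq.
Qed.

Lemma tame_of_poly_in N phi f g : poisson_automorphism phi ->
    phi x0 = poly_in f -> phi x1 = poly_in g ->
  (size (dehom f) + size (dehom g) < N)%N -> tame_automorphism phi.
Proof.
elim: N phi f g => // N IHN.
have key phi f g : poisson_automorphism phi -> phi x0 = poly_in f -> phi x1 = poly_in g ->
    (size (dehom f) + size (dehom g) < N.+1)%N ->
    (size (dehom f) <= size (dehom g))%N -> tame_automorphism phi.
  move=> phiA fE gE lt fg.
  have [f1 g1 red] := automorphism_reduction phiA fE gE.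
  have [g2|g2] := leqP (size (dehom g)) 2.
    have lin G : (size (dehom G) <= 2)%N -> poly_in G =
        ((G`_0)`_1) *: x0 + ((G`_1)`_0) *: x1 + ((G`_0)`_0)%:A.
      move=> sG; rewrite {1}(dehom_linear sG) /poly_in !evPD !evPM !evPC evPX evPY.
      by rewrite -!scalerAl !mul1r -addrA addrC.
    apply: (affine_tame phiA); first by rewrite fE lin // (leq_trans fg).
    by rewrite gE lin.
  have [c [q ltq]] := red fg g2.
  (* Precomposing [phi] with this elementary automorphism keeps [f] and replaces [g] by
     [g - c f^q]. *)
  have ff : free_of ord_max ((- c) *: x0 ^+ q).
    by apply: free_ofZ; apply: free_ofX; apply: free_of_x0.
  have eA := elem_elementary (oner_neq0 k) ff.
  have phiP := proj1 phiA.
  apply: (tame_comp_elem (oner_neq0 k) ff).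
  apply: (IHN _ f (g - c%:P%:P * f ^+ q)).
  - exact: pauto_comp phiA (proj1 eA).
  - by rewrite /= elem_pvar_neq.
  - rewrite /= elem_pvar scale1r (pmorphD phiP) gE (pmorphZ phiP).
    have -> : phi (x0 ^+ q) = poly_in f ^+ q.
      rewrite -fE; elim: (q) => [|j IHj]; first by rewrite !expr0 (pmorph1 phiP).
      by rewrite !exprS (pmorphM phiP) IHj.
    rewrite /poly_in evPD evPN evPM evPC evPXn.
    by rewrite -scalerAl mul1r scaleNr.
  - by rewrite -ltnS; apply: leq_ltn_trans lt; rewrite ltn_add2l.
move=> phi f g phiA fE gE lt.
have [le|/ltnW le] := leqP (size (dehom f)) (size (dehom g)); first exact: (key phi f g).
apply: tame_comp_swap; apply: (key _ g f) => //.
- exact: pauto_comp phiA swap_automorphism.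
- by rewrite /= swap0.
- by rewrite /= swap1.
- by rewrite addnC.
Qed.

End PlaneAutomorphisms.

Theorem corollary4 (k : fieldType) (char0 : [pchar k]%R =i pred0)
    (phi : freePoisson k 2 -> freePoisson k 2)
    (phi_aut : poisson_automorphism phi) :
  tame_automorphism phi.
Proof.
have [f fE] := poly_inP (automorphism_polysub char0 phi_aut ord0).
have [g gE] := poly_inP (automorphism_polysub char0 phi_aut ord_max).
exact: (tame_of_poly_in char0 phi_aut fE gE (ltnSn _)).
Qed.
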